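(* There exist universal constants $c_0, c_1, C, \tilde C, \tilde D > 0$, with $c_0$ a positive integer (none of them depending on $m,n,r,d,\delta,L,f$), such that the following holds. Let $1\le r\le m\le n$ be integers, $\delta\in(0,1)$, and let $f:\mathbb{R}^{m\times n}\to\mathbb{R}$ be differentiable and $L$-smooth with respect to the Frobenius norm, with $(\delta,r)$-approximately-low-rank gradients. Let $d = 2c_0 r(m+n)$ and let $Z_1,\dots,Z_d\in\mathbb{R}^{m\times n}$ be random matrices all of whose entries are independent $\mathcal{N}(0,1/d)$ variables, with sensing operator $\mathcal{Z}$. Let $X_k\in\mathbb{R}^{m\times n}$ be the current iterate (possibly random and possibly depending on $Z_1,\dots,Z_d$) and let $\vec y=\mathcal{Z}(\nabla f(X_k))$. Let $\hat G = G^t$ be the output of $t$ iterations of iterative hard thresholding applied to $(\mathcal{Z},\vec y)$, started at $G^0=0$ with constant step size $\eta = 1/(1+\delta_{2r}(\mathcal{Z}))$, where $$t \ \ge\ \tilde D\,\log\!\left(\frac{\|\vec y\|^2}{\left(\tilde C\frac{m}{r}+2\right)\delta^2\|\nabla f(X_k)\|^2}\right)$$ (no condition on $t$ if $\nabla f(X_k)=0$ or $\vec y = 0$). Then, with probability at least $1-e^{-c_1 d}$, one has $\delta_{2r}(\mathcal{Z})<1/3$ and $$\|\nabla f(X_k)-\hat G\|^2\ \le\ \left(8C\frac{m}{r}+5\right)\delta^2\,\|\nabla f(X_k)\|^2 .$$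
   Context: Norms on $\mathbb{R}^{m\times n}$ written $\|\cdot\|$ are Frobenius norms, coming from $\langle A,B\rangle=\mathrm{trace}(A^\top B)$; on vectors $\|\cdot\|$ is the Euclidean norm. $L$-smooth: $\|\nabla f(X)-\nabla f(Y)\|\le L\|X-Y\|$ for all $X,Y$. $\mathrm{Proj}_r(A)$ denotes a nearest matrix of rank at most $r$ to $A$ in Frobenius norm (obtained from the SVD of $A$ by keeping the $r$ largest singular values). $A$ is $(\delta,r)$-approximately-low-rank if $\|A-\mathrm{Proj}_r(A)\|\le\delta\|A\|$; $f$ has $(\delta,r)$-approximately-low-rank gradients if $\nabla f(X)$ is $(\delta,r)$-approximately-low-rank for every $X$. Sensing operator: $\mathcal{Z}:\mathbb{R}^{m\times n}\to\mathbb{R}^d$, $[\mathcal{Z}(A)]_i=\langle Z_i,A\rangle$, with adjoint $\mathcal{Z}^*(\vec y)=\sum_i y_iZ_i$. Thus the $i$-th entry of $\mathcal{Z}(\nabla f(X))$ is the directional derivative $D_{Z_i}f(X)$. Restricted isometry: $\delta_s(\mathcal{Z})$ is the smallest $\delta'\in(0,1)$ such that $(1-\delta')\|G\|^2\le\|\mathcal{Z}(G)\|^2\le(1+\delta')\|G\|^2$ for all $G$ of rank at most $s$ (when such a $\delta'$ exists). Iterative hard thresholding (IHT) with step size $\eta$: $G^{t+1}=\mathrm{Proj}_r\big(G^t-\eta\,\mathcal{Z}^*(\mathcal{Z}(G^t)-\vec y)\big)$. *)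

(* Defs.v *)
From HB Require Import structures.
From mathcomp Require Import all_boot all_order all_algebra.
From mathcomp Require Import all_classical all_reals all_analysis.
Set Implicit Arguments.
Unset Strict Implicit.
Unset Printing Implicit Defensive.
Import Order.TTheory GRing.Theory Num.Theory.
Import numFieldNormedType.Exports.
Local Open Scope classical_set_scope.
Local Open Scope ring_scope.

Definition frob_inner (R : realType) (m n : nat) (A B : 'M[R]_(m, n)) : R :=
  \tr (A^T *m B).

(* The normedModType structure of 'M[R]_(m, n) carries the max norm, so the
   Frobenius norm is defined here; on 'cV[R]_d it is the Euclidean norm. *)
Definition frob_norm (R : realType) (m n : nat) (A : 'M[R]_(m, n)) : R :=
  Num.sqrt (frob_inner A A).

Definition grad (R : realType) (m n : nat) (f : 'M[R]_(m, n) -> R)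
    (X : 'M[R]_(m, n)) : 'M[R]_(m, n) :=
  \matrix_(i, j) 'D_(delta_mx i j) f X.

(* For differentiable f, grad is the gradient for the Frobenius product. *)
Lemma frob_inner_grad (R : realType) (m n : nat) (f : 'M[R]_(m, n) -> R)
    (X A : 'M[R]_(m, n)) :
  differentiable f X -> frob_inner (grad f X) A = 'D_A f X.
Proof.
move=> fX; rewrite deriveE// [in RHS](matrix_sum_delta A) linear_sum.
rewrite /frob_inner /mxtrace.
under eq_bigr do rewrite mxE.
rewrite exchange_big /=; apply: eq_bigr => i _.
rewrite linear_sum; apply: eq_bigr => j _.
by rewrite linearZ !mxE deriveE// mulrC.
Qed.

Definition L_smooth (R : realType) (m n : nat) (L : R)
    (f : 'M[R]_(m, n) -> R) : Prop :=
  forall X Y, frob_norm (grad f X - grad f Y) <= L * frob_norm (X - Y).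

(* Nearest points need not be unique, so Proj_r is a relation:
   B is a possible value of Proj_r(A). *)
Definition is_proj (R : realType) (m n r : nat) (A B : 'M[R]_(m, n)) : Prop :=
  (\rank B <= r)%N /\
  forall B' : 'M[R]_(m, n), (\rank B' <= r)%N ->
    frob_norm (A - B) <= frob_norm (A - B').

(* The distance to Proj_r(A) does not depend on the chosen nearest point. *)
Definition approx_low_rank (R : realType) (m n : nat) (delta : R) (r : nat)
    (A : 'M[R]_(m, n)) : Prop :=
  exists2 B, is_proj r A B & frob_norm (A - B) <= delta * frob_norm A.

Definition sensing (R : realType) (m n d : nat) (Z : 'I_d -> 'M[R]_(m, n))
    (A : 'M[R]_(m, n)) : 'cV[R]_d :=
  \col_k frob_inner (Z k) A.

Definition sensing_adj (R : realType) (m n d : nat) (Z : 'I_d -> 'M[R]_(m, n))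
    (y : 'cV[R]_d) : 'M[R]_(m, n) :=
  \sum_k y k 0 *: Z k.

Definition rip (R : realType) (m n d : nat) (Z : 'I_d -> 'M[R]_(m, n))
    (s : nat) (delta' : R) : Prop :=
  forall A : 'M[R]_(m, n), (\rank A <= s)%N ->
    (1 - delta') * frob_norm A ^+ 2 <= frob_norm (sensing Z A) ^+ 2 /\
    frob_norm (sensing Z A) ^+ 2 <= (1 + delta') * frob_norm A ^+ 2.

(* The least admissible delta' in (0, 1), and +oo when there is none; the
   infimum is attained unless it is 0 (exact isometry on rank <= s). *)
Definition ric (R : realType) (m n d : nat) (Z : 'I_d -> 'M[R]_(m, n))
    (s : nat) : \bar R :=
  ereal_inf [set delta'%:E | delta' in [set x : R | 0 < x < 1 /\ rip Z s x]].

Definition is_iht (R : realType) (m n d : nat) (Z : 'I_d -> 'M[R]_(m, n))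
    (y : 'cV[R]_d) (r : nat) (eta : R) (G : nat -> 'M[R]_(m, n)) : Prop :=
  G 0%N = 0 /\
  forall s, is_proj r (G s - eta *: sensing_adj Z (sensing Z (G s) - y))
              (G s.+1).

(* The product rule over all of I contains the one over each subfamily, by
   taking B i = setT outside the subfamily. *)
Definition independent_RVs (R : realType) (disp : measure_display)
    (T : measurableType disp) (P : probability T R) (I : finType)
    (X : I -> {RV P >-> R}) : Prop :=
  forall B : I -> set R, (forall i, measurable (B i)) ->
    P [set w | forall i, B i (X i w)] = (\prod_i P (X i @^-1` B i))%E.

(* v is the variance, whereas normal_prob takes the standard deviation. *)
Definition gaussian_RV (R : realType) (disp : measure_display)
    (T : measurableType disp) (P : probability T R) (mu v : R)
    (X : {RV P >-> R}) : Prop :=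
  forall B : set R, measurable B ->
    distribution P X B = normal_prob mu (Num.sqrt v) B.

(* Main.v *)
Require Import Defs.
From HB Require Import structures.
From mathcomp Require Import all_boot all_order all_algebra.
From mathcomp Require Import all_classical all_reals all_analysis.
From mathcomp Require Import measurable_realfun.
From mathcomp Require Import ring lra zify.
Set Implicit Arguments.
Unset Strict Implicit.
Unset Printing Implicit Defensive.
Import Order.TTheory GRing.Theory Num.Theory.
Import numFieldNormedType.Exports.
Local Open Scope classical_set_scope.
Local Open Scope ring_scope.

(* Only the restricted isometry property of Z on matrices of rank <= 2r matters.

   Deterministic part. Write grad f = B + E with rank B <= r and |E| <= delta
   |grad f|. A projected step minimizes a quadratic majorant of |Z G - y|^2, so
   this residual contracts by the factor 1/2 up to the noise |Z E|^2. Cutting E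
   into blocks of 2r rows and applying the isometry to each of them bounds
   |Z E|^2 by a multiple of (m / r) |E|^2, which makes a separate estimate of the
   operator norm of Z unnecessary, uniformly in the (random) iterate X.

   Probabilistic part. For a fixed A, |Z A|^2 is |A|^2 / d times a chi-square
   variable with d degrees of freedom. Its two tails are controlled through
   Gaussian moment generating functions only. A matrix of rank <= s and norm 1
   factors as U V with |U|^2 <= s and |V| = 1; rounding the entries of U, then
   those of V, each time so that the rounding errors do not add up, gives a net
   of size exp(O(s(m+n))) whose error terms again have rank <= s. *)

(** * Frobenius norm and sensing operators *)

Section frobenius.
Context (R : realType) (m n : nat).
Implicit Types A B C : 'M[R]_(m, n).

Lemma frob_innerE A B : frob_inner A B = \sum_i \sum_j A i j * B i j.
Proof.
rewrite /frob_inner /mxtrace exchange_big; apply: eq_bigr => j _ /=.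
by rewrite mxE; apply: eq_bigr => i _; rewrite mxE.
Qed.

Lemma frob_innerC A B : frob_inner A B = frob_inner B A.
Proof.
rewrite !frob_innerE; apply: eq_bigr => i _; apply: eq_bigr => j _.
exact: mulrC.
Qed.

Lemma frob_innerDr C A B :
  frob_inner C (A + B) = frob_inner C A + frob_inner C B.
Proof. by rewrite /frob_inner mulmxDr mxtraceD. Qed.

Lemma frob_innerZr C a A : frob_inner C (a *: A) = a * frob_inner C A.
Proof. by rewrite /frob_inner -scalemxAr mxtraceZ. Qed.

Lemma frob_innerNr C A : frob_inner C (- A) = - frob_inner C A.
Proof. by rewrite -scaleN1r frob_innerZr mulN1r. Qed.

Lemma frob_innerDl C A B :
  frob_inner (A + B) C = frob_inner A C + frob_inner B C.
Proof. by rewrite frob_innerC frob_innerDr !(frob_innerC C). Qed.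

Lemma frob_innerZl C a A : frob_inner (a *: A) C = a * frob_inner A C.
Proof. by rewrite frob_innerC frob_innerZr (frob_innerC C). Qed.

Lemma frob_innerNl C A : frob_inner (- A) C = - frob_inner A C.
Proof. by rewrite frob_innerC frob_innerNr (frob_innerC C). Qed.

Lemma frob_inner0r A : frob_inner A 0 = 0.
Proof. by rewrite /frob_inner mulmx0 mxtrace0. Qed.

Lemma frob_inner_sumr (I : finType) C (F : I -> 'M[R]_(m, n)) :
  frob_inner C (\sum_i F i) = \sum_i frob_inner C (F i).
Proof. by rewrite /frob_inner mulmx_sumr raddf_sum. Qed.

Lemma frob_inner_suml (I : finType) C (F : I -> 'M[R]_(m, n)) :
  frob_inner (\sum_i F i) C = \sum_i frob_inner (F i) C.
Proof.
by rewrite frob_innerC frob_inner_sumr; apply: eq_bigr => i _; rewrite frob_innerC.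
Qed.

Lemma frob_inner_ge0 A : 0 <= frob_inner A A.
Proof.
by rewrite frob_innerE; do 2 apply: sumr_ge0 => ? _; rewrite -expr2 sqr_ge0.
Qed.

Lemma frob_norm_ge0 A : 0 <= frob_norm A.
Proof. exact: sqrtr_ge0. Qed.

Lemma sqr_frob_norm A : frob_norm A ^+ 2 = frob_inner A A.
Proof. by rewrite sqr_sqrtr ?frob_inner_ge0. Qed.

Lemma sqr_frob_normE A : frob_norm A ^+ 2 = \sum_i \sum_j A i j ^+ 2.
Proof. by rewrite sqr_frob_norm frob_innerE. Qed.

Lemma frob_norm0 : frob_norm (0 : 'M[R]_(m, n)) = 0.
Proof. by rewrite /frob_norm frob_inner0r sqrtr0. Qed.

Lemma frob_norm0_eq0 A : frob_norm A = 0 -> A = 0.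
Proof.
move=> A0; have := sqr_frob_normE A; rewrite A0 expr0n => /esym/eqP.
rewrite psumr_eq0 => [/allP Ai0|i _]; last by apply: sumr_ge0 => j _; exact: sqr_ge0.
apply/matrixP => i j; rewrite mxE.
have /= := Ai0 i; rewrite mem_index_enum psumr_eq0 => [/(_ isT)/allP/(_ j)|? _].
  by rewrite mem_index_enum => /(_ isT)/=; rewrite sqrf_eq0 => /eqP.
exact: sqr_ge0.
Qed.

Lemma frob_norm_gt0 A : A != 0 -> 0 < frob_norm A.
Proof.
move=> A0; rewrite lt_neqAle frob_norm_ge0 andbT eq_sym.
by apply: contra A0 => /eqP/frob_norm0_eq0 ->.
Qed.

Lemma frob_normN A : frob_norm (- A) = frob_norm A.
Proof. by rewrite /frob_norm frob_innerNl frob_innerNr opprK. Qed.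

Lemma frob_normZ a A : frob_norm (a *: A) = `|a| * frob_norm A.
Proof.
by rewrite /frob_norm frob_innerZl frob_innerZr mulrA -expr2 sqrtrM ?sqr_ge0//
  sqrtr_sqr.
Qed.

Lemma sqr_frob_normD A B : frob_norm (A + B) ^+ 2 =
  frob_norm A ^+ 2 + 2 * frob_inner A B + frob_norm B ^+ 2.
Proof.
rewrite !sqr_frob_norm frob_innerDl !frob_innerDr (frob_innerC B A); ring.
Qed.

Lemma sqr_frob_normB A B : frob_norm (A - B) ^+ 2 =
  frob_norm A ^+ 2 - 2 * frob_inner A B + frob_norm B ^+ 2.
Proof. by rewrite sqr_frob_normD frob_innerNr frob_normN mulrN. Qed.

Lemma sqr_frob_normD_le A B :
  frob_norm (A + B) ^+ 2 <= 2 * (frob_norm A ^+ 2 + frob_norm B ^+ 2).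
Proof.
by have := sqr_ge0 (frob_norm (A - B)); rewrite sqr_frob_normB sqr_frob_normD;
  lra.
Qed.

Lemma frob_inner_le A B : frob_inner A B <= frob_norm A * frob_norm B.
Proof.
have [->|A0] := eqVneq A 0.
  by rewrite frob_innerC frob_inner0r frob_norm0 mul0r.
have [->|B0] := eqVneq B 0; first by rewrite frob_inner0r frob_norm0 mulr0.
have a0 := frob_norm_gt0 A0; have b0 := frob_norm_gt0 B0.
have := sqr_ge0 (frob_norm (frob_norm B *: A - frob_norm A *: B)).
rewrite sqr_frob_normB !frob_normZ !ger0_norm ?frob_norm_ge0//.
rewrite frob_innerZl frob_innerZr.
have ab0 := mulr_gt0 a0 b0.
move: a0 b0 ab0; set a := frob_norm A; set b := frob_norm B => a0 b0 ab0.
move=> H; rewrite -(ler_pM2l ab0); nra.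
Qed.

Lemma ler_frob_normD A B : frob_norm (A + B) <= frob_norm A + frob_norm B.
Proof.
rewrite -(@ler_pXn2r _ 2) ?nnegrE ?addr_ge0 ?frob_norm_ge0//.
by rewrite sqr_frob_normD; have := frob_inner_le A B; nra.
Qed.

End frobenius.

Lemma frob_norm_trmx (R : realType) (m n : nat) (A : 'M[R]_(m, n)) :
  frob_norm A^T = frob_norm A.
Proof. by rewrite /frob_norm /frob_inner trmxK mxtrace_mulC. Qed.

Section sensing_operator.
Context (R : realType) (m n d : nat) (Z : 'I_d -> 'M[R]_(m, n)).

Lemma sensingD A B : sensing Z (A + B) = sensing Z A + sensing Z B.
Proof. by apply/matrixP => i j; rewrite !mxE frob_innerDr. Qed.

Lemma sensingN A : sensing Z (- A) = - sensing Z A.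
Proof. by apply/matrixP => i j; rewrite !mxE frob_innerNr. Qed.

Lemma sensingB A B : sensing Z (A - B) = sensing Z A - sensing Z B.
Proof. by rewrite sensingD sensingN. Qed.

Lemma sensingZ a A : sensing Z (a *: A) = a *: sensing Z A.
Proof. by apply/matrixP => i j; rewrite !mxE frob_innerZr. Qed.

Lemma sensing0 : sensing Z 0 = 0.
Proof. by apply/matrixP => i j; rewrite !mxE frob_inner0r. Qed.

Lemma sensing_adjP (v : 'cV[R]_d) A :
  frob_inner (sensing_adj Z v) A = frob_inner v (sensing Z A).
Proof.
rewrite [RHS]frob_innerE /frob_inner /sensing_adj linear_sum mulmx_suml.
rewrite linear_sum; apply: eq_bigr => k _.
by rewrite big_ord1 mxE linearZ -scalemxAl linearZ.
Qed.

Lemma sqr_frob_norm_sensing A :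
  frob_norm (sensing Z A) ^+ 2 = \sum_k frob_inner (Z k) A ^+ 2.
Proof.
by rewrite sqr_frob_normE; apply: eq_bigr => k _; rewrite big_ord1 mxE.
Qed.

End sensing_operator.

(** * Iterative hard thresholding under restricted isometry *)

Section restricted_isometry.
Context (R : realType) (m n d : nat) (Z : 'I_d -> 'M[R]_(m, n)).
Implicit Types (A B G : 'M[R]_(m, n)) (y : 'cV[R]_d) (r s : nat).

(** For a fixed matrix the isometry inequalities are closed conditions on the constant, so they pass
    to the infimum. The step size of the iteration involves this infimum itself, hence the need for
    the isometry with exactly that constant. *)
Lemma ric_attained s (x : R) : 0 < x < 1 -> rip Z s x ->
  [/\ 0 <= fine (ric Z s) <= x, ric Z s = (fine (ric Z s))%:E &
      rip Z s (fine (ric Z s))].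
Proof.
move=> x01 ripx.
have ric0 : (0 <= ric Z s)%E.
  by apply: le_ereal_inf_tmp => _ [u [/andP[u0 _] _] <-]; rewrite lee_fin ltW.
have ricx : (ric Z s <= x%:E)%E by apply: ereal_inf_lbound; exists x.
have ricE : ric Z s = (fine (ric Z s))%:E.
  by rewrite fineK// ge0_fin_numE// (le_lt_trans ricx)// ltry.
split=> //.
  by move: ric0 ricx; rewrite ricE !lee_fin => -> ->.
have near_ric e : 0 < e -> exists2 u, u < fine (ric Z s) + e & rip Z s u.
  move=> e0; have : (ric Z s < (fine (ric Z s) + e)%:E)%E.
    by rewrite {1}ricE lte_fin ltrDl.
  by move=> /ereal_inf_lt[_ [u [_ ?] <-]]; rewrite lte_fin; exists u.
move=> A rA; split.
- apply/ler_addgt0Pr => e e0.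
  have [->|A0] := eqVneq A 0; first by rewrite sensing0 !frob_norm0 expr0n mulr0 add0r ltW.
  have a0 : 0 < frob_norm A ^+ 2 by rewrite exprn_gt0// frob_norm_gt0.
  have [u ulte /(_ A rA)[+ _]] := near_ric (e / frob_norm A ^+ 2) (divr_gt0 e0 a0).
  move=> Hu; have : (fine (ric Z s) + e / frob_norm A ^+ 2 - u) * frob_norm A ^+ 2 >= 0.
    by rewrite mulr_ge0// ltW// subr_gt0.
  by rewrite mulrBl mulrDl divfK ?gt_eqF//; lra.
- apply/ler_addgt0Pr => e e0.
  have [->|A0] := eqVneq A 0; first by rewrite sensing0 !frob_norm0 expr0n mulr0 add0r ltW.
  have a0 : 0 < frob_norm A ^+ 2 by rewrite exprn_gt0// frob_norm_gt0.
  have [u ulte /(_ A rA)[_ +]] := near_ric (e / frob_norm A ^+ 2) (divr_gt0 e0 a0).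
  move=> Hu; have : (fine (ric Z s) + e / frob_norm A ^+ 2 - u) * frob_norm A ^+ 2 >= 0.
    by rewrite mulr_ge0// ltW// subr_gt0.
  by rewrite mulrBl mulrDl divfK ?gt_eqF//; lra.
Qed.

Lemma mxrankB_le r A B : (\rank A <= r)%N -> (\rank B <= r)%N ->
  (\rank (A - B)%R <= 2 * r)%N.
Proof.
move=> rA rB; rewrite (leq_trans (mxrank_add _ _))// mxrank_opp mul2n -addnn.
exact: leq_add.
Qed.

(* By the upper isometry bound, B |-> |Z B - y|^2 is majorized on matrices of
   rank <= r by |Z G - y|^2 + 2 <W, B - G> + (1 + rho) |B - G|^2 with
   W = Z^*(Z G - y), and a projected step minimizes this majorant. *)
Lemma iht_step r rho y G G' B : 0 <= rho <= 1 / 9 -> rip Z (2 * r) rho ->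
  (\rank G <= r)%N -> (\rank B <= r)%N ->
  is_proj r (G - (1 / (1 + rho)) *: sensing_adj Z (sensing Z G - y)) G' ->
  frob_norm (sensing Z G' - y) ^+ 2 <=
  1 / 2 * frob_norm (sensing Z G - y) ^+ 2 +
  3 / 2 * frob_norm (sensing Z B - y) ^+ 2.
Proof.
move=> rho9 ripZ rG rB [rG' /(_ B rB)].
set W := sensing_adj _ _; set eta := 1 / (1 + rho) => projG'.
have [] := ripZ _ (mxrankB_le rG' rG); have [] := ripZ _ (mxrankB_le rB rG).
have resE C : sensing Z C - y = sensing Z (C - G) + (sensing Z G - y).
  by rewrite sensingB addrA subrK.
have ZGD C : frob_norm (sensing Z C - y) ^+ 2 =
    frob_norm (sensing Z (C - G)) ^+ 2 + 2 * frob_inner W (C - G)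
    + frob_norm (sensing Z G - y) ^+ 2.
  by rewrite resE sqr_frob_normD sensing_adjP (frob_innerC (sensing Z G - y)).
have ZBG : frob_norm (sensing Z (B - G)) ^+ 2 <=
    2 * (frob_norm (sensing Z B - y) ^+ 2 + frob_norm (sensing Z G - y) ^+ 2).
  have -> : sensing Z (B - G) = (sensing Z B - y) + - (sensing Z G - y).
    by rewrite resE addrK.
  by rewrite (le_trans (sqr_frob_normD_le _ _))// frob_normN.
have rho0 : 1 + rho != 0 by apply: lt0r_neq0; lra.
have majG : (1 + rho) * frob_norm (G' - G) ^+ 2 + 2 * frob_inner W (G' - G) <=
    (1 + rho) * frob_norm (B - G) ^+ 2 + 2 * frob_inner W (B - G).
  (* Completing the square: for this step size, the squared distance to the gradient step, times
     [1 + rho], is the majorant up to a term independent of [C]. Comparing distances therefore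
     compares majorants. *)
  have PE C : (1 + rho) * frob_norm (G - eta *: W - C) ^+ 2 =
      (1 + rho) * frob_norm (C - G) ^+ 2 + 2 * frob_inner W (C - G)
      + eta * frob_norm W ^+ 2.
    have -> : G - eta *: W - C = - ((C - G) + eta *: W).
      by rewrite !opprD opprK addrAC (addrC (- C)).
    rewrite frob_normN sqr_frob_normD frob_innerZr frob_normZ exprMn.
    rewrite real_normK ?num_real// (frob_innerC W) /eta; field.
    exact: rho0.
  have := PE G'; have := PE B => EB EG'.
  have : (1 + rho) * frob_norm (G - eta *: W - G') ^+ 2 <=
         (1 + rho) * frob_norm (G - eta *: W - B) ^+ 2.
    rewrite ler_pM2l; last by lra.
    by rewrite ler_pXn2r// nnegrE frob_norm_ge0.
  by rewrite EB EG' lerD2r.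
have EB := ZGD B; rewrite ZGD.
have := sqr_ge0 (frob_norm (B - G)); move: majG ZBG EB.
set a := frob_norm (B - G) ^+ 2; set b := frob_norm (G' - G) ^+ 2.
set p := frob_norm (sensing Z (B - G)) ^+ 2; set q := frob_norm (sensing Z (G' - G)) ^+ 2.
set u := frob_inner W _; set v := frob_inner W _.
set w := frob_norm (_ - y) ^+ 2; set z := frob_norm (sensing Z B - y) ^+ 2.
move=> majG ZBG EB a0 p1 p2 q1 q2.
case/andP: rho9 => rho1 rho2.
(* The new residual is at most |Z B - y|^2 + 2 rho |B - G|^2. By the lower isometry bound the last
   term is at most |Z (B - G)|^2 / 4, hence at most half the sum of the residuals of [B] and [G];
   this gives the factors 3/2 and 1/2. *)
have : rho * a <= 1 / 9 * a by rewrite ler_wpM2r.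
lra.
Qed.

(** The noise factor 3 is the fixed point of x -> x / 2 + 3 / 2. The rank claim belongs to the
    induction because [iht_step] starts from a matrix of rank <= r. *)
Lemma iht_residual r rho y (G : nat -> 'M[R]_(m, n)) B t :
  0 <= rho <= 1 / 9 -> rip Z (2 * r) rho ->
  (\rank B <= r)%N -> is_iht Z y r (1 / (1 + rho)) G ->
  (\rank (G t) <= r)%N /\
  frob_norm (sensing Z (G t) - y) ^+ 2 <=
  (1 / 2) ^+ t * frob_norm y ^+ 2 + 3 * frob_norm (sensing Z B - y) ^+ 2.
Proof.
move=> rho9 ripZ rB [G0 Gs]; elim: t => [|t [rGt IH]].
  rewrite G0 mxrank0 sensing0 sub0r frob_normN expr0 mul1r; split => //.
  by have := sqr_ge0 (frob_norm (sensing Z B - y)); lra.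
split; first by have [] := Gs t.
have := iht_step rho9 ripZ rGt rB (Gs t).
move: IH; rewrite (exprS _ t) -[X in _ -> _ -> _ <= X + _]mulrA.
by move: (_ ^+ t * _) => u; lra.
Qed.

Lemma sqr_frob_norm_sum (q : nat) (v : 'I_q -> 'cV[R]_d) :
  frob_norm (\sum_b v b) ^+ 2 <= q%:R * \sum_b frob_norm (v b) ^+ 2.
Proof.
rewrite sqr_frob_norm.
have -> : frob_inner (\sum_b v b) (\sum_b v b) =
    \sum_a \sum_b frob_inner (v a) (v b).
  by rewrite frob_inner_suml; apply: eq_bigr => a _; rewrite frob_inner_sumr.
apply: (@le_trans _ _ (\sum_a \sum_b
    (frob_norm (v a) ^+ 2 + frob_norm (v b) ^+ 2) / 2)).
  apply: ler_sum => a _; apply: ler_sum => b _.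
  by have := sqr_ge0 (frob_norm (v a - v b)); rewrite sqr_frob_normB; lra.
under eq_bigr do rewrite -mulr_suml big_split sumr_const/= card_ord.
rewrite -mulr_suml big_split/= sumr_const/= card_ord sumrMnl.
by rewrite mulr_natl mulrDl -splitr.
Qed.

(* Cutting A into blocks of s consecutive rows yields orthogonal matrices of
   rank <= s, to each of which the isometry bound applies. *)
Lemma rip_sensing_bound s rho A : (0 < s)%N -> 0 <= rho -> rip Z s rho ->
  frob_norm (sensing Z A) ^+ 2 <=
  (1 + rho) * (m%:R / s%:R + 1) * frob_norm A ^+ 2.
Proof.
(* The additional block takes the remaining rows; it is empty when [s] divides [m]. *)
move=> s0 rho0 ripZ; pose q := (m %/ s)%N.+1.
pose blk (b : 'I_q) : 'M[R]_(m, n) :=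
  \matrix_(i, j) if (i %/ s == b)%N then A i j else 0.
have iq (i : 'I_m) : (i %/ s < q)%N by rewrite ltnS leq_div2r// ltnW.
have blkE : A = \sum_b blk b.
  apply/matrixP => i j; rewrite summxE (bigD1 (Ordinal (iq i)))//= mxE eqxx.
  rewrite big1 ?addr0// => b bi; rewrite mxE ifF//.
  by apply: contraNF bi => /eqP bi; apply/eqP/val_inj; rewrite /= bi.
have rk b : (\rank (blk b) <= s)%N.
  (* [V] holds the rows of the block, with zero rows at positions beyond [m], and [U] puts them back
     in place. *)
  pose U : 'M[R]_(m, s) := \matrix_(i, k) (i == b * s + k :> nat)%N%:R.
  pose V : 'M[R]_(s, n) := \matrix_(k, j)
    if insub (b * s + k)%N is Some i then A i j else 0.
  suff -> : blk b = U *m V by exact: leq_trans (mxrankM_maxl _ _) (rank_leq_col _).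
  apply/matrixP => i j; rewrite !mxE; case: eqP => [ib|ib].
    have ks : (i %% s < s)%N by rewrite ltn_mod.
    have bik : (b * s + i %% s)%N = i by rewrite -ib -divn_eq.
    rewrite (bigD1 (Ordinal ks))//= big1 => [|k ki].
      rewrite !mxE/= bik eqxx mul1r addr0.
      by case: insubP => [? _ /val_inj ->//|]; rewrite ltn_ord.
    rewrite mxE (_ : (i == _ :> nat) = false) ?mul0r//.
    apply: contraNF ki => /eqP ik; apply/eqP/val_inj => /=.
    by rewrite ik modnMDl modn_small.
  rewrite big1// => k _; rewrite mxE (_ : (i == _ :> nat) = false) ?mul0r//.
  apply/eqP => ik; apply: ib.
  by rewrite ik divnMDl// divn_small ?addn0.
have blk_norm : \sum_b frob_norm (blk b) ^+ 2 = frob_norm A ^+ 2.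
  under eq_bigr do rewrite sqr_frob_normE.
  rewrite exchange_big sqr_frob_normE; apply: eq_bigr => i _ /=.
  rewrite exchange_big; apply: eq_bigr => j _ /=.
  rewrite (bigD1 (Ordinal (iq i)))//= mxE eqxx big1 ?addr0// => b bi.
  rewrite mxE ifF ?expr0n//.
  by apply: contraNF bi => /eqP bi; apply/eqP/val_inj; rewrite /= bi.
have -> : sensing Z A = \sum_b sensing Z (blk b).
  apply/matrixP => k l; rewrite summxE mxE {1}blkE frob_inner_sumr.
  by apply: eq_bigr => b _; rewrite mxE.
rewrite (le_trans (sqr_frob_norm_sum _))//.
apply: (@le_trans _ _ (q%:R * \sum_b (1 + rho) * frob_norm (blk b) ^+ 2)).
  rewrite ler_wpM2l// ler_sum// => b _.
  by have [] := ripZ _ (rk b).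
rewrite -mulr_sumr blk_norm mulrCA mulrA ler_wpM2r ?sqr_ge0//.
rewrite ler_wpM2l; [by []|lra|].
rewrite /q -[X in X%:R]addn1 natrD lerD2r ler_pdivlMr ?ltr0n// -natrM ler_nat.
exact: leq_divM.
Qed.

(** Since 2^t = exp(t ln 2), log_2 x halvings bring x down to 1. This fixes the factor 1 / ln 2 in
    the iteration count. *)
Lemma half_exp_le (x : R) t : 0 < x -> (ln 2)^-1 * ln x <= t%:R ->
  (1 / 2) ^+ t * x <= 1.
Proof.
move=> x0; have ln2 : 0 < ln (2 : R) by rewrite ln_gt0// ltr1n.
rewrite ler_pdivrMl// mulrC => H.
rewrite -(lnK x0) div1r exprVn mulrC ler_pdivrMr ?exprn_gt0// mul1r.
rewrite -[X in X ^+ t](@lnK R) ?posrE// -expRM_natl ler_expR//.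
Qed.

(** The iterate is compared with the low-rank approximation [B] of [g]. Their difference has rank <=
    2r, so the lower isometry bound converts residuals back into distances. *)
Lemma iht_error r rho delta g (G : nat -> 'M[R]_(m, n)) t :
  (0 < r)%N -> (r <= m)%N -> 0 < delta ->
  0 <= rho <= 1 / 9 -> rip Z (2 * r) rho -> approx_low_rank delta r g ->
  is_iht Z (sensing Z g) r (1 / (1 + rho)) G ->
  (g != 0 -> sensing Z g != 0 ->
    (ln 2)^-1 * ln (frob_norm (sensing Z g) ^+ 2 /
      ((1 * (m%:R / r%:R) + 2) * delta ^+ 2 * frob_norm g ^+ 2)) <= t%:R) ->
  frob_norm (g - G t) ^+ 2 <=
  (8 * 6 * (m%:R / r%:R) + 5) * delta ^+ 2 * frob_norm g ^+ 2.
Proof.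
move=> r0 rm d0 rho9 ripZ [B [rB _] gB] ihtG tge.
set y := sensing Z g in ihtG tge *; set k := m%:R / r%:R in tge *.
have k1 : 1 <= k by rewrite ler_pdivlMr ?ltr0n// mul1r ler_nat.
have [rGt resG] := iht_residual t rho9 ripZ rB ihtG.
have {}gB : frob_norm (g - B) ^+ 2 <= delta ^+ 2 * frob_norm g ^+ 2.
  rewrite -exprMn ler_pXn2r// nnegrE ?frob_norm_ge0// mulr_ge0 ?frob_norm_ge0//.
  exact: ltW.
(* The row-block bound with blocks of 2r rows gives the factor 10/9 (k / 2 + 1), which is at most
   5/3 k because [k >= 1]. *)
have resB : frob_norm (sensing Z B - y) ^+ 2 <= 5 / 3 * k * frob_norm (g - B) ^+ 2.
  rewrite -frob_normN opprB -sensingB.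
  have s0 : (0 < 2 * r)%N by rewrite muln_gt0.
  have rho0 : 0 <= rho by lra.
  apply: (le_trans (rip_sensing_bound (g - B) s0 rho0 ripZ)).
  rewrite ler_wpM2r ?sqr_ge0//.
  have -> : m%:R / (2 * r)%:R = k / 2 :> R.
    by rewrite natrM invfM mulrA [LHS]mulrAC mulrAC.
  nra.
(* If [g] or [y] vanishes, [t] is unconstrained but the left side is zero. *)
have decay : (1 / 2) ^+ t * frob_norm y ^+ 2 <=
    (k + 2) * delta ^+ 2 * frob_norm g ^+ 2.
  have [g0|g0] := eqVneq g 0.
    by rewrite /y g0 sensing0 !frob_norm0 expr0n !mulr0.
  have kdg : 0 < (1 * k + 2) * delta ^+ 2 * frob_norm g ^+ 2.
    by rewrite !mulr_gt0 ?exprn_gt0// ?frob_norm_gt0//; lra.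
  have [y0|y0] := eqVneq y 0.
    by rewrite y0 frob_norm0 expr0n mulr0 mulr_ge0 ?sqr_ge0// mulr_ge0 ?sqr_ge0//; lra.
  have /half_exp_le/(_ (tge g0 y0)) : 0 < frob_norm y ^+ 2 /
      ((1 * k + 2) * delta ^+ 2 * frob_norm g ^+ 2).
    by rewrite divr_gt0// exprn_gt0// frob_norm_gt0.
  by rewrite mulrA ler_pdivrMr// !mul1r.
have gGt : frob_norm (g - G t) ^+ 2 <=
    2 * (frob_norm (g - B) ^+ 2 + frob_norm (B - G t) ^+ 2).
  have -> : g - G t = (g - B) + (B - G t) by rewrite addrA subrK.
  exact: sqr_frob_normD_le.
have BGt : 8 / 9 * frob_norm (B - G t) ^+ 2 <=
    2 * (frob_norm (sensing Z B - y) ^+ 2 + frob_norm (sensing Z (G t) - y) ^+ 2).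
  have [ripl _] := ripZ _ (mxrankB_le rB rGt).
  have : frob_norm (sensing Z (B - G t)) ^+ 2 <=
      2 * (frob_norm (sensing Z B - y) ^+ 2 + frob_norm (sensing Z (G t) - y) ^+ 2).
    rewrite -(frob_normN (sensing Z (G t) - y)) sensingB.
    have -> : sensing Z B - sensing Z (G t) =
        (sensing Z B - y) + - (sensing Z (G t) - y) by rewrite opprB addrA subrK.
    exact: sqr_frob_normD_le.
  move=> H; apply: le_trans H; apply: le_trans ripl.
  by rewrite ler_wpM2r ?sqr_ge0//; lra.
(* With D = delta^2 |g|^2 the estimates add up to (69/2 k + 11) D, which is below (48 k + 5) D since
   [k >= 1]. *)
have := mulr_ge0 (sqr_ge0 delta) (sqr_ge0 (frob_norm g)).
move: gB decay; rewrite -!(mulrA _ (delta ^+ 2)); set D := delta ^+ 2 * _ => gB decay D0.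
nra.
Qed.

End restricted_isometry.

(** * Nets of low-rank matrices *)

Section block_norms.
Context (R : realType).

Lemma sqr_frob_norm_col_mx (m1 m2 n : nat) (A : 'M[R]_(m1, n)) (B : 'M[R]_(m2, n)) :
  frob_norm (col_mx A B) ^+ 2 = frob_norm A ^+ 2 + frob_norm B ^+ 2.
Proof. by rewrite !sqr_frob_norm /frob_inner tr_col_mx mul_row_col mxtraceD. Qed.

Lemma sqr_frob_norm_row_mx (m n1 n2 : nat) (A : 'M[R]_(m, n1)) (B : 'M[R]_(m, n2)) :
  frob_norm (row_mx A B) ^+ 2 = frob_norm A ^+ 2 + frob_norm B ^+ 2.
Proof. by rewrite -frob_norm_trmx tr_row_mx sqr_frob_norm_col_mx !frob_norm_trmx. Qed.

Lemma sqr_frob_norm_rows (m n : nat) (A : 'M[R]_(m, n)) :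
  frob_norm A ^+ 2 = \sum_i frob_norm (row i A) ^+ 2.
Proof.
rewrite sqr_frob_normE; apply: eq_bigr => i _.
by rewrite sqr_frob_normE big_ord1; apply: eq_bigr => j _; rewrite mxE.
Qed.

(* Gram-Schmidt on the column space; the columns of U are orthonormal or zero. *)
Lemma rank_factor (m n s : nat) (A : 'M[R]_(m, n)) : (\rank A <= s)%N ->
  exists (U : 'M[R]_(m, s)) (V : 'M[R]_(s, n)),
    [/\ A = U *m V, frob_norm U ^+ 2 <= s%:R & frob_norm V ^+ 2 = frob_norm A ^+ 2].
Proof.
elim: s A => [|s IH] A rA.
  exists 0, 0; split; rewrite ?frob_norm0 ?expr0n//.
    by rewrite mulmx0; apply/eqP; rewrite -mxrank_eq0 -leqn0.
  move: rA; rewrite leqn0 mxrank_eq0 => /eqP ->.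
  by rewrite frob_norm0 expr0n.
have [->|A0] := eqVneq A 0.
  by exists 0, 0; split; rewrite ?mulmx0 ?frob_norm0 ?expr0n.
have [j0 u0] : exists j, col j A != 0.
  apply/existsP; rewrite -negb_forall; apply: contra A0 => /forallP H.
  apply/eqP/matrixP => i j; have /eqP/matrixP/(_ i 0) := H j.
  by rewrite !mxE.
set u := col j0 A in u0.
have uN0 : frob_norm u != 0 by rewrite gt_eqF// frob_norm_gt0.
pose e := (frob_norm u)^-1 *: u.
have ee : e^T *m e = 1%:M.
  rewrite [LHS]mx11_scalar -trace_mx11 -/(frob_inner e e) -sqr_frob_norm.
  by rewrite frob_normZ ger0_norm ?invr_ge0 ?frob_norm_ge0// mulVf// expr1n.
pose w := e^T *m A.
pose B := A - e *m w.
have eB : e^T *m B = 0 by rewrite mulmxBr mulmxA ee mul1mx subrr.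
have rB : (\rank B <= s)%N.
  (* The rank drops strictly: the columns of [B] lie in the column space of [A], which also contains
     [e], whereas [e] is a unit vector orthogonal to all columns of [B]. *)
  rewrite -ltnS (leq_trans _ rA)// -[\rank B]mxrank_tr -[\rank A]mxrank_tr.
  have eA : (e^T <= A^T)%MS.
    by rewrite linearZ/= scalemx_sub// /u tr_col row_sub.
  apply: rank_ltmx; rewrite ltmxE; apply/andP; split.
    rewrite linearB/= trmx_mul.
    by rewrite addmx_sub// eqmx_opp mulmx_sub.
  apply/negP => /(submx_trans eA)/submxP[C eC].
  have : e^T *m e = 0 by rewrite eC -mulmxA -[B^T *m e]trmxK trmx_mul trmxK eB trmx0 mulmx0.
  by rewrite ee => /matrixP/(_ 0 0)/eqP; rewrite !mxE oner_eq0.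
have [U [V [BE UN VN]]] := IH B rB.
exists (row_mx e U), (col_mx w V); split.
- by rewrite (mul_row_col e U w V) -BE /B addrC subrK.
- rewrite (sqr_frob_norm_row_mx e U) -[s.+1]addn1 natrD addrC lerD//.
  by rewrite sqr_frob_norm /frob_inner ee mxtrace1.
- rewrite (sqr_frob_norm_col_mx w V) VN /B sqr_frob_normB.
  have -> : frob_norm (e *m w) ^+ 2 = frob_norm w ^+ 2.
    rewrite !sqr_frob_norm /frob_inner trmx_mul -mulmxA (mulmxA e^T) ee.
    by rewrite mul1mx.
  have -> : frob_inner A (e *m w) = frob_norm w ^+ 2.
    by rewrite sqr_frob_norm /frob_inner /w !mulmxA trmx_mul trmxK.
  ring.
Qed.

(* Rounding up or down the next coefficient, one of the two choices makes the
   new error term have nonpositive inner product with the accumulated error. *)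
Lemma round_row (p n : nat) (h : R) (x : 'rV[R]_p) (V : 'M[R]_(p, n)) : 0 < h ->
  exists k : 'rV[int]_p,
    (forall j, `|x 0 j - h * (k 0 j)%:~R| <= h) /\
    frob_norm ((x - h *: map_mx intr k) *m V) ^+ 2 <= h ^+ 2 * frob_norm V ^+ 2.
Proof.
move=> h0; elim: p x V => [|p IH] x V.
  exists 0; split=> [[]//|].
  by rewrite [x - _]thinmx0 mul0mx frob_norm0 expr0n mulr_ge0 ?sqr_ge0.
pose x' : 'rV[R]_(1 + p) := x; pose V' : 'M[R]_(1 + p, n) := V.
have [k [kx kV]] := IH (rsubmx x') (dsubmx V').
set err := (_ *m dsubmx V') in kV.
pose v := usubmx V'.
pose x0 := x 0 0.
pose f := Num.floor (x0 / h).
have /andP[fl fu] : f%:~R * h <= x0 < (f + 1)%:~R * h.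
  by rewrite -ler_pdivlMr// -ltr_pdivrMr// floor_itv.
have [d [dh dv]] : exists d : int,
    `|x0 - h * d%:~R| <= h /\ (x0 - h * d%:~R) * frob_inner err v <= 0.
  move: fu; rewrite intrD mulrDl mul1r => fu.
  have [ev|ev] := lerP (frob_inner err v) 0.
    exists f; rewrite mulr_ge0_le0 ?ger0_norm//; lra.
  exists (f + 1); rewrite intrD mulrDr mulr1 mulr_le0_ge0 ?ler0_norm//; lra.
suff : exists k : 'rV[int]_(1 + p),
    (forall j, `|x' 0 j - h * (k 0 j)%:~R| <= h) /\
    frob_norm ((x' - h *: map_mx intr k) *m V') ^+ 2 <= h ^+ 2 * frob_norm V' ^+ 2.
  by [].
exists (row_mx (d%:M : 'rV_1) k); split.
  move=> j; case: (split_ordP j) => j' ->.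
    rewrite row_mxEl (ord1 j') mxE mulr1n (_ : x' 0 _ = x0)//.
    by congr (x _ _); exact/val_inj.
  by have := kx j'; rewrite row_mxEr mxE.
have -> : (x' - h *: map_mx intr (row_mx (d%:M : 'rV_1) k)) *m V' =
    (x0 - h * d%:~R) *: v + err.
  rewrite -{1}[x']hsubmxK -{1}[V']vsubmxK.
  rewrite map_row_mx scale_row_mx opp_row_mx add_row_mx mul_row_col.
  congr (_ + _); rewrite -[RHS]mul_scalar_mx; congr (_ *m _).
  apply/matrixP => i j; rewrite !ord1 !mxE !mulr1n; congr (x _ _ - _).
  exact/val_inj.
rewrite sqr_frob_normD frob_normZ exprMn real_normK ?num_real//.
rewrite frob_innerZl (frob_innerC v) -[V' in leRHS]vsubmxK.
rewrite sqr_frob_norm_col_mx -/v mulrDr lerD//.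
rewrite -[leRHS]addr0 lerD//; last by rewrite pmulr_rle0.
by rewrite ler_wpM2r ?sqr_ge0// -[leLHS]real_normK ?num_real// ler_pXn2r ?nnegrE// ltW.
Qed.

(** Rows are rounded separately, and their squared errors add up to the factor [m]. Entrywise
    rounding combined with Cauchy-Schwarz would cost a further factor [s]. *)
Lemma round_mx (m s n : nat) (h : R) (U : 'M[R]_(m, s)) (V : 'M[R]_(s, n)) : 0 < h ->
  exists k : 'M[int]_(m, s),
    (forall i j, `|U i j - h * (k i j)%:~R| <= h) /\
    frob_norm ((U - h *: map_mx intr k) *m V) ^+ 2 <=
      h ^+ 2 * m%:R * frob_norm V ^+ 2.
Proof.
move=> h0; have /fin_all_exists[k kP] i := round_row (row i U) V h0.
exists (\matrix_i k i); split=> [i j|].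
  by have [/(_ j)] := kP i; rewrite !mxE.
rewrite sqr_frob_norm_rows mulrAC -mulrA mulr_natr -[m in leRHS]card_ord -sumr_const.
rewrite mulr_sumr ler_sum// => i _.
rewrite (_ : row i _ = (row i U - h *: map_mx intr (k i)) *m V); last first.
  by rewrite row_mul; congr (_ *m _); apply/rowP => j; rewrite !mxE.
by have [_] := kP i.
Qed.

End block_norms.

(** A vector is coded by its absolute values and the set of its negative entries. The former are
    counted by a binomial coefficient, one term of the expansion of (1 + 1)^(#|I| + K), and the
    latter are 2^#|I| in number. *)
Lemma cover_int_vectors (I : finType) (K : nat) :
  exists (J : finType) (phi : J -> I -> int), (#|J| <= 4 ^ (#|I| + K))%N /\
    forall k : I -> int, (\sum_i `|k i| <= K)%N -> exists j, phi j =1 k.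
Proof.
pose S := [set t : #|I|.-tuple 'I_K.+1 | (\sum_(i <- t) i <= K)%N]%SET.
pose J : finType := ({t | t \in S} * {set I})%type.
pose phi (j : J) (i : I) : int :=
  if i \in j.2 then - (tnth (val j.1) (enum_rank i))%:Z
  else (tnth (val j.1) (enum_rank i))%:Z.
exists J, phi; split.
  rewrite card_prod card_sig -[#|{set I}|]cardsT -powersetT card_powerset cardsT.
  have -> : #|[pred x in S]| = 'C(#|I| + K, #|I|).
    by rewrite -card_partial_ord_partitions; apply: eq_card => t; rewrite !inE.
  rewrite (_ : 4 = 2 * 2)%N// expnMn leq_mul//.
    rewrite -[(2 ^ _)%N]/((1 + 1) ^ _)%N expnDn.
    have lt : (#|I| < (#|I| + K).+1)%N by rewrite ltnS leq_addr.
    by rewrite (bigD1 (Ordinal lt))//= !exp1n !muln1 leq_addr.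
  by rewrite leq_exp2l// leq_addr.
move=> k kK.
have kle i : (`|k i| < K.+1)%N.
  by rewrite ltnS (leq_trans _ kK)// (bigD1 i)//= leq_addr.
pose t : #|I|.-tuple 'I_K.+1 := [tuple Ordinal (kle (enum_val i)) | i < #|I|].
have tS : t \in S.
  rewrite inE big_tuple (leq_trans _ kK)//.
  rewrite [leqRHS](reindex (@enum_val I predT))/=; last exact: onW_bij (enum_val_bij _).
  by apply: eq_leq; apply: eq_bigr => i _; rewrite tnth_mktuple.
exists (exist _ t tS, [set i | k i < 0]%SET) => i; rewrite /phi /=.
rewrite tnth_mktuple enum_rankK inE /=.
by case: ltP => ki; lia.
Qed.

(** Controls the l1 size required by [cover_int_vectors]. With y = |x| / h, each coefficient is at
    most y + 1 <= y^2 / (2 M) + M / 2 + 1, and the norm hypothesis makes the mean of the quadratic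
    terms at most M / 2. *)
Lemma round_sum_abs (R : realType) (p q M : nat) (h : R) (X : 'M[R]_(p, q))
    (k : 'M[int]_(p, q)) : 0 < h -> (0 < M)%N ->
  (forall i j, `|X i j - h * (k i j)%:~R| <= h) ->
  frob_norm X ^+ 2 <= h ^+ 2 * M%:R ^+ 2 * (p * q)%:R ->
  (\sum_(ij : 'I_p * 'I_q) `|k ij.1 ij.2| <= M.+1 * (p * q))%N.
Proof.
move=> h0 M0 kX XN; rewrite -(ler_nat R) natr_sum.
have M0' : 0 < M%:R :> R by rewrite ltr0n.
apply: (@le_trans _ _ (\sum_(ij : 'I_p * 'I_q)
    (X ij.1 ij.2 ^+ 2 / (2 * M%:R * h ^+ 2) + (M%:R / 2 + 1)))).
  apply: ler_sum => -[i j] _ /=.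
  rewrite natr_absz intr_norm.
  have := kX i j; set x := X i j; set z := (k i j)%:~R => kx.
  have hz : h * `|z| <= `|x| + h.
    rewrite -[X in X * _](gtr0_norm h0) -normrM.
    have -> : h * z = x - (x - h * z) by ring.
    by rewrite (le_trans (ler_normB _ _))// lerD2l.
  have [y yx] : exists y, `|x| = h * y by exists (`|x| / h); rewrite mulrC divfK ?gt_eqF.
  have -> : x ^+ 2 / (2 * M%:R * h ^+ 2) = y ^+ 2 / (2 * M%:R).
    rewrite -[x ^+ 2]real_normK ?num_real// yx; field.
    by rewrite !gt_eqF.
  have {}hz : `|z| <= y + 1.
    by rewrite -(ler_pM2l h0) mulrDr -yx mulr1.
  apply: (le_trans hz); rewrite addrA lerD2r.
  rewrite -subr_ge0 (_ : _ - _ = (y - M%:R) ^+ 2 / (2 * M%:R)).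
    by rewrite divr_ge0 ?sqr_ge0// mulr_ge0// ltW.
  by field; rewrite gt_eqF.
rewrite big_split sumr_const card_prod !card_ord -mulr_suml /=.
rewrite -[X in _ + X]mulr_natr.
rewrite -(pair_bigA _ (fun i j => X i j ^+ 2))/= -sqr_frob_normE.
set c := (p * q)%:R in XN *.
have : frob_norm X ^+ 2 / (2 * M%:R * h ^+ 2) <= M%:R / 2 * c.
  rewrite ler_pdivrMr ?mulr_gt0 ?exprn_gt0//; apply: (le_trans XN).
  suff -> : M%:R / 2 * c * (2 * M%:R * h ^+ 2) = h ^+ 2 * M%:R ^+ 2 * c by [].
  by field.
rewrite natrM -[M.+1]addn1 natrD -/c; clearbody c; lra.
Qed.


(* The error D1 + D2 is kept as a sum of two matrices of rank <= s, so that it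
   can be absorbed by the same restricted operator norm. *)
Lemma low_rank_net (R : realType) (m n s N : nat) :
  (0 < m)%N -> (0 < n)%N -> (0 < s)%N -> (0 < N)%N ->
  exists (J : finType) (phi : J -> 'M[R]_(m, n)),
    (#|J| <= 4 ^ ((2 * N).+2 * (s * (m + n))))%N /\
    forall A : 'M[R]_(m, n), (\rank A <= s)%N -> frob_norm A = 1 ->
    exists j D1 D2, [/\ A = phi j + (D1 + D2),
      (\rank D1 <= s)%N, (\rank D2 <= s)%N,
      frob_norm D1 <= N%:R^-1 & frob_norm D2 <= N%:R^-1].
Proof.
move=> m0 n0 s0 N0.
have N0' : 0 < N%:R :> R by rewrite ltr0n.
have m0' : 0 < m%:R :> R by rewrite ltr0n.
have n0' : 0 < n%:R :> R by rewrite ltr0n.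
have s0' : 0 < s%:R :> R by rewrite ltr0n.
(* The mesh sizes satisfy m h1^2 = N^-2 and n h2^2 (4 s) = N^-2, where 4 s bounds the squared norm
   of the rounded left factor. *)
pose h1 : R := (N%:R * Num.sqrt m%:R)^-1.
pose h2 : R := (2 * N%:R * Num.sqrt (n * s)%:R)^-1.
have ns0 : 0 < (n * s)%:R :> R by rewrite ltr0n muln_gt0 n0.
have h1_gt0 : 0 < h1 by rewrite invr_gt0 mulr_gt0// sqrtr_gt0.
have h2_gt0 : 0 < h2 by rewrite invr_gt0 !mulr_gt0// sqrtr_gt0.
have h1E : h1 ^+ 2 = (N%:R ^+ 2 * m%:R)^-1.
  by rewrite exprVn exprMn sqr_sqrtr// ltW.
have h2E : h2 ^+ 2 = (4 * N%:R ^+ 2 * (n%:R * s%:R))^-1.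
  by rewrite exprVn !exprMn sqr_sqrtr ?(ltW ns0)// natrM; congr (_ * _ * _)^-1; ring.
(* The budgets come from [round_sum_abs]: M = N for the left factor, as s = h1^2 N^2 (m s), and M =
   2 N for the right one, as 1 = h2^2 (2 N)^2 (n s). *)
have [J1 [phi1 [J1c phi1P]]] := cover_int_vectors ('I_m * 'I_s)%type (N.+1 * (m * s)).
have [J2 [phi2 [J2c phi2P]]] := cover_int_vectors ('I_n * 'I_s)%type ((2 * N).+1 * (n * s)).
pose U (j : J1 * J2) : 'M[R]_(m, s) := h1 *: \matrix_(i, k) (phi1 j.1 (i, k))%:~R.
pose V (j : J1 * J2) : 'M[R]_(n, s) := h2 *: \matrix_(i, k) (phi2 j.2 (i, k))%:~R.
exists (J1 * J2)%type, (fun j => U j *m (V j)^T); split.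
  rewrite card_prod; apply: leq_trans (leq_mul J1c J2c) _.
  rewrite -expnD leq_exp2l// !card_prod !card_ord; nia.
move=> A rA A1; have [UA [VA [AE UN VN]]] := rank_factor rA.
rewrite A1 expr1n in VN.
have [k1 [k1h k1e]] := round_mx UA VA h1_gt0.
have /phi1P[j1 j1P] : (\sum_ij `|k1 ij.1 ij.2| <= N.+1 * (m * s))%N.
  apply: (round_sum_abs h1_gt0 N0 k1h); rewrite h1E natrM.
  rewrite (_ : _ * (m%:R * s%:R) = s%:R)//.
  by field; rewrite !gt_eqF.
pose U' : 'M[R]_(m, s) := h1 *: map_mx intr k1.
(* The right factor is rounded against the already rounded [U'], so the total error splits into two
   products through dimension [s], each of rank <= [s]. *)
have [k2 [k2h k2e]] := round_mx VA^T U'^T h2_gt0.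
have /phi2P[j2 j2P] : (\sum_ij `|k2 ij.1 ij.2| <= (2 * N).+1 * (n * s))%N.
  apply: (round_sum_abs h2_gt0 _ k2h); first by rewrite muln_gt0.
  rewrite frob_norm_trmx VN h2E !natrM (_ : _ * (n%:R * s%:R) = 1)//.
  by field; rewrite !gt_eqF.
have UE : U (j1, j2) = U'.
  by apply/matrixP => i j; rewrite !mxE j1P.
have U'N : frob_norm U' ^+ 2 <= 4 * s%:R.
  have -> : U' = UA + - (UA - U') by rewrite opprB addrC subrK.
  rewrite (le_trans (sqr_frob_normD_le _ _))// frob_normN.
  suff : frob_norm (UA - U') ^+ 2 <= s%:R by lra.
  rewrite sqr_frob_normE; apply: (@le_trans _ _ (\sum_(i < m) \sum_(j < s) h1 ^+ 2)).
    apply: ler_sum => i _; apply: ler_sum => j _.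
    rewrite !mxE -[leLHS]real_normK ?num_real// ler_pXn2r ?nnegrE//.
    exact: ltW.
  rewrite !sumr_const !card_ord -mulrnA -[leLHS]mulr_natr h1E natrM.
  rewrite (_ : _ * (s%:R * m%:R) = s%:R / N%:R ^+ 2); last by field; rewrite !gt_eqF.
  rewrite ler_pdivrMr ?exprn_gt0// ler_peMr ?exprn_ege1 ?ler1n//; exact: ltW.
pose V' : 'M[R]_(n, s) := h2 *: map_mx intr k2.
have VE : V (j1, j2) = V'.
  by apply/matrixP => i j; rewrite !mxE j2P.
have normV (B : 'M[R]_(m, n)) : frob_norm B ^+ 2 <= N%:R^-1 ^+ 2 -> frob_norm B <= N%:R^-1.
  by rewrite ler_pXn2r// nnegrE ?frob_norm_ge0// invr_ge0 ltW.
exists (j1, j2), ((UA - U') *m VA), (U' *m (VA - V'^T)); split.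
- by rewrite UE VE AE mulmxBl mulmxBr subrKA addrC subrK.
- exact: leq_trans (mxrankM_maxl _ _) (rank_leq_col _).
- exact: leq_trans (mxrankM_maxl _ _) (rank_leq_col _).
- apply: normV; apply: (le_trans k1e); rewrite VN h1E.
  suff -> : (N%:R ^+ 2 * m%:R)^-1 * m%:R * 1 = N%:R^-1 ^+ 2 :> R by [].
  by field; rewrite !gt_eqF.
- apply: normV; rewrite -frob_norm_trmx trmx_mul linearB/= trmxK.
  apply: (le_trans k2e); rewrite frob_norm_trmx h2E.
  rewrite (_ : N%:R^-1 ^+ 2 =
    (4 * N%:R ^+ 2 * (n%:R * s%:R))^-1 * n%:R * (4 * s%:R)); last first.
    by field; rewrite !gt_eqF.
  by rewrite ler_wpM2l// mulr_ge0// invr_ge0 !mulr_ge0// ltW.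
Qed.

(** * From a net to the restricted isometry property *)

Lemma frob_normalize (R : realType) (m n : nat) (A : 'M[R]_(m, n)) : A != 0 ->
  exists B, [/\ A = frob_norm A *: B, \rank B = \rank A & frob_norm B = 1].
Proof.
move=> A0; have a0 : frob_norm A != 0 by rewrite gt_eqF// frob_norm_gt0.
exists ((frob_norm A)^-1 *: A); split.
- by rewrite scalerA mulfV// scale1r.
- by rewrite eqmx_scale// invr_eq0.
- by rewrite frob_normZ ger0_norm ?invr_ge0 ?frob_norm_ge0// mulVf.
Qed.

Section net_to_rip.
Context (R : realType) (m n d : nat) (Z : 'I_d -> 'M[R]_(m, n)).

(** A crude Cauchy-Schwarz bound, which makes the set of restricted operator bounds in [net_rip]
    nonempty. *)
Lemma sensing_bounded : exists2 M, 0 <= M &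
  forall A, frob_norm (sensing Z A) <= M * frob_norm A.
Proof.
exists (Num.sqrt (\sum_k frob_norm (Z k) ^+ 2)); first exact: sqrtr_ge0.
move=> A; rewrite -(@ler_pXn2r _ 2) ?nnegrE ?mulr_ge0 ?sqrtr_ge0 ?frob_norm_ge0//.
rewrite exprMn [X in _ <= X * _]sqr_sqrtr; last by apply: sumr_ge0 => k _; exact: sqr_ge0.
rewrite sqr_frob_norm_sensing mulr_suml ler_sum// => k _.
rewrite -exprMn -[leLHS]real_normK ?num_real//.
rewrite ler_pXn2r ?nnegrE ?mulr_ge0 ?frob_norm_ge0//.
rewrite ler_norml frob_inner_le andbT lerNl -frob_innerNl.
by rewrite (le_trans (frob_inner_le _ _))// frob_normN.
Qed.

(** The net errors again have rank <= [s], so the restricted operator norm controls their images.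
    This gives a self-bounding inequality for that norm, and then a two-sided comparison of each
    unit matrix with its net point. *)
Lemma net_rip (s : nat) (J : finType) (phi : J -> 'M[R]_(m, n)) :
  (forall A, (\rank A <= s)%N -> frob_norm A = 1 ->
    exists j D1 D2, [/\ A = phi j + (D1 + D2),
      (\rank D1 <= s)%N, (\rank D2 <= s)%N,
      frob_norm D1 <= 200^-1 & frob_norm D2 <= 200^-1]) ->
  (forall j, (1 - 50^-1) * frob_norm (phi j) ^+ 2 <= frob_norm (sensing Z (phi j)) ^+ 2
             <= (1 + 50^-1) * frob_norm (phi j) ^+ 2) ->
  rip Z s (1 / 9).
Proof.
move=> net ripJ.
have phi_bd j : 98 / 100 * frob_norm (phi j) <= frob_norm (sensing Z (phi j))
    <= 101 / 100 * frob_norm (phi j).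
  have := ripJ j; have := frob_norm_ge0 (phi j).
  have := frob_norm_ge0 (sensing Z (phi j)).
  set a := frob_norm (phi j); set b := frob_norm _ => b0 a0 /andP[lo up].
  apply/andP; split.
    by rewrite -(@ler_pXn2r _ 2) ?nnegrE// ?exprMn; nra.
  by rewrite -(@ler_pXn2r _ 2) ?nnegrE// ?exprMn; nra.
(* The least restricted operator norm M satisfies M <= 1.021 + M / 100. *)
pose S : set R := [set M | 0 <= M /\
  forall A, (\rank A <= s)%N -> frob_norm (sensing Z A) <= M * frob_norm A].
have S0 : S !=set0.
  by have [M M0 MP] := sensing_bounded; exists M; split => // A _.
have lbS : has_lbound S by exists 0 => M [].
have infS0 : 0 <= inf S by apply: lb_le_inf => // M [].
(* Each defining bound is closed in [M], so the infimum is itself admissible. *)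
have infS : S (inf S).
  split => // A rA.
  have [->|A0] := eqVneq A 0; first by rewrite sensing0 !frob_norm0 mulr0.
  rewrite -ler_pdivrMr ?frob_norm_gt0//.
  by apply: lb_le_inf => // M [_ /(_ A rA)]; rewrite ler_pdivrMr ?frob_norm_gt0.
set M := inf S in infS infS0; have [_ MP] := infS.
have decomp A : (\rank A <= s)%N -> frob_norm A = 1 ->
    exists2 B, (99 / 100 <= frob_norm B <= 101 / 100) /\
      98 / 100 * frob_norm B <= frob_norm (sensing Z B) <= 101 / 100 * frob_norm B &
    frob_norm (sensing Z B) - M / 100 <= frob_norm (sensing Z A) <=
    frob_norm (sensing Z B) + M / 100.
  move=> rA A1; have [j [D1 [D2 [AE r1 r2 d1 d2]]]] := net A rA A1.
  have D12 : frob_norm (D1 + D2) <= 1 / 100.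
    by rewrite (le_trans (ler_frob_normD _ _))//; lra.
  have ZD12 : frob_norm (sensing Z (D1 + D2)) <= M / 100.
    have e1 : M * frob_norm D1 <= M * 200^-1 by rewrite ler_wpM2l.
    have e2 : M * frob_norm D2 <= M * 200^-1 by rewrite ler_wpM2l.
    rewrite sensingD (le_trans (ler_frob_normD _ _))//.
    by have := MP _ r1; have := MP _ r2; lra.
  have phiE : phi j = A + - (D1 + D2) by rewrite AE addrK.
  exists (phi j); [split => //|]; apply/andP; split.
  - have := ler_frob_normD (phi j) (D1 + D2); rewrite -AE A1; lra.
  - have := ler_frob_normD A (- (D1 + D2)); rewrite -phiE A1 frob_normN; lra.
  - have := ler_frob_normD (sensing Z A) (- sensing Z (D1 + D2)).
    rewrite -sensingB -phiE frob_normN; lra.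
  - have := ler_frob_normD (sensing Z (phi j)) (sensing Z (D1 + D2)).
    rewrite -sensingD -AE; lra.
have Mle : M <= 1032 / 1000.
  (* A net point has norm at most 1.01 and is stretched by at most 1.01, and 1.01^2 < 1.021. *)
  suff : S (1021 / 1000 + M / 100) by move=> /(ge_inf lbS); rewrite -/M; lra.
  split; first lra.
  move=> A rA; have [->|A0] := eqVneq A 0; first by rewrite sensing0 !frob_norm0 mulr0.
  have [B [AE rB B1]] := frob_normalize A0.
  rewrite {1}AE sensingZ frob_normZ ger0_norm ?frob_norm_ge0// mulrC.
  rewrite ler_wpM2r ?frob_norm_ge0//.
  have [|C []] := decomp B _ B1; first by rewrite rB.
  by lra.
move=> A rA; have [->|A0] := eqVneq A 0.
  by rewrite sensing0 !frob_norm0 expr0n !mulr0.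
have [B [AE rB B1]] := frob_normalize A0.
(* Both numbers lie between the square roots of 8/9 and 10/9. *)
have : 94 / 100 + 1 / 60 <= frob_norm (sensing Z B) <= 105 / 100.
  have [|C []] := decomp B _ B1; first by rewrite rB.
  by lra.
rewrite AE sensingZ !frob_normZ B1 mulr1 ger0_norm ?frob_norm_ge0//.
rewrite exprMn; set b := frob_norm (sensing Z B); have := sqr_ge0 (frob_norm A).
set a := frob_norm A ^+ 2 => a0 /andP[bl bu].
rewrite ![_ * a]mulrC !ler_wpM2l//; nra.
Qed.

End net_to_rip.

(** * Independent random variables *)

Section density.
Local Open Scope ereal_scope.
Context (d d' : measure_display) (T : measurableType d) (U : measurableType d')
  (R : realType) (mu : {measure set T -> \bar R}) (nu : {measure set U -> \bar R}).

Import HBNNSimple.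

(** Approximation by simple functions. The case [X = id] is integration against a density, [H = 1]
    is the law of a random variable, and the general case serves independence. *)
Lemma ge0_integral_density (X : T -> U) (H : T -> R) (f : U -> \bar R) :
  measurable_fun [set: T] X ->
  measurable_fun [set: T] H -> (forall x, (0 <= H x)%R) ->
  (forall B, measurable B -> nu B = \int[mu]_(x in X @^-1` B) (H x)%:E) ->
  measurable_fun [set: U] f -> (forall y, 0 <= f y) ->
  \int[nu]_y f y = \int[mu]_x (f (X x) * (H x)%:E).
Proof.
move=> mX mH H0 nuE mf f0; pose h := nnsfun_approx measurableT mf.
have cvgh y : (h n y)%:E @[n --> \oo] --> f y by exact: cvg_nnsfun_approx.
have ndh y : {homo (fun n => (h n y)%:E) : a b / (a <= b)%N >-> a <= b}.
  by move=> a b ab; rewrite lee_fin; exact/lefP/nd_nnsfun_approx.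
have mhX n : measurable_fun [set: T] (fun x => (h n (X x))%:E).
  by apply/measurable_EFinP; apply: measurableT_comp => //; exact: measurable_funP.
have -> : \int[nu]_y f y = limn (fun n => \int[nu]_y (h n y)%:E).
  rewrite -monotone_convergence//.
  - by apply: eq_integral => y _; apply/esym/cvg_lim => //; exact: cvgh.
  - by move=> n; exact/measurable_EFinP/measurable_funP.
  - by move=> n y _; rewrite lee_fin.
have -> : \int[mu]_x (f (X x) * (H x)%:E) =
    limn (fun n => \int[mu]_x ((h n (X x))%:E * (H x)%:E)).
  rewrite -monotone_convergence//.
  - apply: eq_integral => x _; apply/esym/cvg_lim => //.
    by apply: cvgeZr => //; exact: cvgh.
  - by move=> n; apply: emeasurable_funM => //; exact/measurable_EFinP.
  - by move=> n x _; rewrite mule_ge0// lee_fin.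
  - by move=> x _ a b ab; apply: lee_wpmul2r; [rewrite lee_fin|exact: ndh].
congr (limn _); apply/funext => n.
transitivity (\sum_(r \in range (h n)) \int[nu]_y (r * \1_(h n @^-1` [set r]) y)%:E).
  rewrite -ge0_integral_fsum//.
  - by apply: eq_integral => y _; rewrite fsumEFin// -fimfunE.
  - by move=> r; exact/measurable_EFinP/measurable_funM.
  - by move=> s y _; exact: nnfun_muleindic_ge0.
transitivity (\sum_(r \in range (h n))
    \int[mu]_x ((r * \1_(h n @^-1` [set r]) (X x))%:E * (H x)%:E)); last first.
  rewrite -ge0_integral_fsum//.
  - apply: eq_integral => x _; rewrite -ge0_mule_fsuml => [|r].
      by rewrite fsumEFin// -fimfunE.
    exact: nnfun_muleindic_ge0.
  - move=> r; apply: emeasurable_funM; last exact/measurable_EFinP.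
    apply/measurable_EFinP/measurable_funM => //.
    by apply: (measurableT_comp _ mX); exact: measurable_indic.
  - move=> s x _; apply: mule_ge0; last by rewrite lee_fin.
    exact: nnfun_muleindic_ge0.
apply: eq_fsbigr => r /set_mem[y _ yr].
have mB : measurable (h n @^-1` [set r]) by [].
under eq_integral do rewrite EFinM.
rewrite ge0_integralZl//; last 2 first.
- exact/measurable_EFinP.
- by rewrite lee_fin -yr.
rewrite integral_indic// setIT nuE//.
under [RHS]eq_integral do rewrite EFinM -muleA.
rewrite ge0_integralZl//.
- congr (_ * _); rewrite integral_mkcond; apply: eq_integral => x _.
  by rewrite muleC epatch_indic.
- apply: emeasurable_funM; last exact/measurable_EFinP.
  apply/measurable_EFinP.
  by apply: (measurableT_comp _ mX); exact: measurable_indic.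
- by move=> x _; rewrite mule_ge0// lee_fin.
- by rewrite lee_fin -yr.
Qed.

End density.

Section independence.
Local Open Scope ereal_scope.
Context (disp : measure_display) (T : measurableType disp) (R : realType)
  (P : probability T R) (I : finType) (X : I -> {RV P >-> R}).

(* The functions F i are treated one at a time; the others are still indicators. *)
Lemma independent_RVs_integral_prod (F : I -> R -> R) :
  independent_RVs X ->
  (forall i, measurable_fun [set: R] (F i)) -> (forall i x, (0 <= F i x)%R) ->
  (forall i, \int[P]_w (F i (X i w))%:E < +oo) ->
  \int[P]_w (\prod_i F i (X i w))%:E = \prod_i \int[P]_w (F i (X i w))%:E.
Proof.
move=> indepX.
have mX i : measurable_fun [set: T] (X i) by exact: measurable_funP.
have mXB i B : measurable B -> measurable (X i @^-1` B).
  by move=> mB; rewrite -[X in measurable X]setTI; exact: mX.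
suff gen (s : seq I) (G : I -> R -> R) :
    (forall i, i \notin s -> exists2 B, measurable B & G i = \1_B) ->
    (forall i, measurable_fun [set: R] (G i)) -> (forall i x, (0 <= G i x)%R) ->
    (forall i, \int[P]_w (G i (X i w))%:E < +oo) ->
    \int[P]_w (\prod_i G i (X i w))%:E = \prod_i \int[P]_w (G i (X i w))%:E.
  by apply: (gen (enum I)) => i; rewrite mem_enum.
elim: s G => [|i0 s IH] G Gs mG G0 Gfin.
  have /fin_all_exists2[B mB GB] i : exists2 B, measurable B & G i = \1_B by exact: Gs.
  have mW : measurable [set w | forall i, B i (X i w)].
    rewrite (_ : [set w | _] = \big[setI/setT]_i (X i @^-1` B i)).
      by apply: bigsetI_measurable => i _; exact: mXB.
    rewrite -bigcap_seq; apply/seteqP; split => w /= Hw i; first by move=> _.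
    by apply: Hw => /=; rewrite mem_index_enum.
  transitivity (P [set w | forall i, B i (X i w)]).
    rewrite -[X in P X]setIT -integral_indic//.
    apply: eq_integral => w _; congr EFin.
    rewrite indicE; have [/set_mem/= Bw|/negP Bw] := boolP (w \in _).
      by rewrite big1// => i _; rewrite GB indicE mem_set.
    have [i Bi] : exists i, ~ B i (X i w).
      by apply/existsNP => Bw'; apply: Bw; rewrite inE.
    by rewrite (bigD1 i)//= GB indicE memNset// mul0r.
  rewrite indepX//; apply: eq_bigr => i _.
  by rewrite GB -[X in P X]setIT -integral_indic//; exact: mXB.
pose H w : R := (\prod_(i | i != i0) G i (X i w))%R.
(* Finiteness of the integrals makes their product a real number, which can then scale a measure. *)
pose c : R := (\prod_(i | i != i0) fine (\int[P]_w (G i (X i w))%:E))%R.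
have GE i : \int[P]_w (G i (X i w))%:E = (fine (\int[P]_w (G i (X i w))%:E))%:E.
  by rewrite fineK// ge0_fin_numE// integral_ge0// => w _; rewrite lee_fin.
have c0 : (0 <= c)%R.
  by apply: prodr_ge0 => i _; rewrite fine_ge0// integral_ge0// => w _; rewrite lee_fin.
have cE : c%:E = \prod_(i | i != i0) \int[P]_w (G i (X i w))%:E.
  by rewrite /c -prodEFin; apply: eq_bigr => i _; rewrite -GE.
have mH : measurable_fun [set: T] H.
  pose h i w : R := if i != i0 then G i (X i w) else 1%R.
  rewrite (_ : H = fun w => (\prod_i h i w)%R).
    apply: measurable_prod => i _; rewrite /h; case: (i != i0) => //.
    exact: measurableT_comp.
  by apply/funext => w; rewrite /H big_mkcond.
have H0 w : (0 <= H w)%R by apply: prodr_ge0.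
(* The induction hypothesis with an indicator at [i0] says that the law of [X i0], scaled by [c], is
   the image of P weighted by [H]. *)
have nuE B : measurable B ->
    mscale (NngNum c0) (distribution P (X i0)) B = \int[P]_(w in X i0 @^-1` B) (H w)%:E.
  move=> mB; pose G' i : R -> R := if i == i0 then \1_B else G i.
  have intB i : \int[P]_w (\1_B (X i w))%:E = P (X i @^-1` B).
    by rewrite -[X in P X]setIT -integral_indic//; exact: mXB.
  have -> : \int[P]_(w in X i0 @^-1` B) (H w)%:E = \int[P]_w (\prod_i G' i (X i w))%:E.
    rewrite integral_mkcond; apply: eq_integral => w _.
    rewrite epatch_indic [in RHS](bigD1 i0)//= /G' eqxx muleC -EFinM.
    congr (_ * _)%R%:E.
    by apply: eq_bigr => i /negbTE ->.
  rewrite IH.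
  - rewrite [RHS](bigD1 i0)//= /G' eqxx intB /mscale/= cE muleC; congr (_ * _).
    by apply: eq_bigr => i /negbTE ->.
  - move=> i si; rewrite /G'; case: eqP => [_|/eqP ii0]; first by exists B.
    by apply: Gs; rewrite inE negb_or ii0.
  - by move=> i; rewrite /G'; case: ifP => // _; exact: measurable_indic.
  - by move=> i x; rewrite /G'; case: ifP.
  - move=> i; rewrite /G'; case: ifP => // _.
    by rewrite intB (le_lt_trans (probability_le1 _ (mXB _ _ mB)))// ltry.
transitivity (\int[P]_w ((G i0 (X i0 w))%:E * (H w)%:E)).
  by apply: eq_integral => w _; rewrite (bigD1 i0)//= EFinM.
rewrite -(ge0_integral_density (mX i0) mH H0 nuE (f := EFin \o G i0)).
- rewrite ge0_integral_mscale//=; last 2 first.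
  + exact/measurable_EFinP.
  + by move=> x _; rewrite lee_fin.
  rewrite ge0_integral_distribution//=; last 2 first.
  + exact/measurable_EFinP.
  + by move=> x; rewrite lee_fin.
  by rewrite [RHS](bigD1 i0)//= -cE muleC.
- exact/measurable_EFinP.
- by move=> x; rewrite lee_fin.
Qed.

End independence.

(** * Gaussian integrals and chi-square tails *)

Section gaussian_integrals.
Local Open Scope ereal_scope.
Context (R : realType).
Implicit Types (m s t u x : R) (f : R -> R).

Lemma ge0_integral_normal_prob m s f :
  measurable_fun [set: R] f -> (forall x, (0 <= f x)%R) ->
  \int[normal_prob m s]_x (f x)%:E =
  \int[lebesgue_measure]_x (f x * normal_pdf m s x)%:E.
Proof.
move=> mf f0.
rewrite (ge0_integral_density (T := measurableTypeR R) (X := id) (mu := lebesgue_measure)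
  _ (measurable_normal_pdf m s) (normal_pdf_ge0 m s))//.
exact/measurable_EFinP.
Qed.

(* e^(tx) times the density of N(0, s^2) is proportional to that of N(ts^2, s^2). *)
Lemma normal_mgf s t : s != 0%R ->
  \int[normal_prob 0 s]_x (expR (t * x))%:E = (expR (t ^+ 2 * s ^+ 2 / 2))%:E.
Proof.
move=> s0; rewrite ge0_integral_normal_prob//; last first.
  by apply: measurableT_comp => //; exact: measurable_funM.
transitivity (\int[lebesgue_measure]_x
    ((expR (t ^+ 2 * s ^+ 2 / 2))%:E * (normal_pdf (t * s ^+ 2) s x)%:E)).
  apply: eq_integral => x _; rewrite -EFinM; congr EFin.
  rewrite /normal_pdf (negbTE s0) /normal_fun mulrCA [RHS]mulrCA -!expRD.
  congr (_ * expR _)%R; field.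
  by rewrite s0.
rewrite ge0_integralZl//; last 2 first.
- by apply/measurable_EFinP; exact: measurable_normal_pdf.
- by move=> x _; rewrite lee_fin normal_pdf_ge0.
by rewrite integral_normal_pdf mule1.
Qed.

(** For u < 1/2, the mean of e^(u z^2) over a standard Gaussian z; the same number is the standard
    deviation of the tilted Gaussian in [normal_sqr_mgf]. *)
Definition chi2_mgf u : R := (Num.sqrt (1 - 2 * u))^-1.

Lemma chi2_mgf_gt0 u : (u < 1 / 2)%R -> (0 < chi2_mgf u)%R.
Proof. by move=> u2; rewrite invr_gt0 sqrtr_gt0; lra. Qed.

Lemma sqr_chi2_mgf u : (u < 1 / 2)%R -> (chi2_mgf u ^+ 2 = (1 - 2 * u)^-1)%R.
Proof. by move=> u2; rewrite exprVn sqr_sqrtr//; lra. Qed.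

(* The density of N(0, 1) times e^(u x^2) is proportional to that of a wider
   centered Gaussian. *)
Lemma normal_sqr_mgf u : (u < 1 / 2)%R ->
  \int[normal_prob 0 1]_x (expR (u * x ^+ 2))%:E = (chi2_mgf u)%:E.
Proof.
move=> u2; rewrite ge0_integral_normal_prob//; last first.
  by apply: measurableT_comp => //; exact: measurable_funM.
have k0 := chi2_mgf_gt0 u2.
transitivity (\int[lebesgue_measure]_x
    ((chi2_mgf u)%:E * (normal_pdf 0 (chi2_mgf u) x)%:E)).
  apply: eq_integral => x _; rewrite -EFinM; congr EFin.
  rewrite /normal_pdf oner_eq0 (gt_eqF k0) /normal_fun /normal_peak mulrCA.
  rewrite sqr_chi2_mgf// -expRD expr1n mul1r [RHS]mulrA. congr (_ * expR _)%R.
    rewrite -mulrnAr sqrtrM ?invr_ge0; last lra.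
    rewrite sqrtrV; last lra.
    by rewrite -/(chi2_mgf u) invfM mulrA mulfV ?mul1r// gt_eqF.
  field; rewrite subr_eq0; apply/eqP; lra.
rewrite ge0_integralZl//; last 3 first.
- by apply/measurable_EFinP; exact: measurable_normal_pdf.
- by move=> x _; rewrite lee_fin normal_pdf_ge0.
- by rewrite lee_fin ltW.
by rewrite integral_normal_pdf mule1.
Qed.

End gaussian_integrals.

Section chi_square.
Local Open Scope ereal_scope.
Context (disp : measure_display) (T : measurableType disp) (R : realType)
  (P : probability T R) (I : finType) (Y : I -> T -> R).
Context (mY : forall i, measurable_fun [set: T] (Y i)).
(** The joint moment generating function of independent standard Gaussians, the form in which
    normality and independence enter the tail bounds. *)
Context (mgfY : forall h : I -> R,
  \int[P]_w (expR (\sum_i h i * Y i w))%:E = (expR (\sum_i h i ^+ 2 / 2))%:E).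

(* Hubbard-Stratonovich: e^(u y^2) is the average of e^(sqrt(2u) z y) over a
   standard Gaussian z, which replaces the squares by linear forms one by one. *)
Lemma integral_expR_sum_sqr (u : I -> R) : (forall i, (0 <= u i < 1 / 2)%R) ->
  \int[P]_w (expR (\sum_i u i * Y i w ^+ 2))%:E = (\prod_i chi2_mgf (u i))%:E.
Proof.
move=> u2.
suff gen (s : seq I) (h : I -> R) :
    \int[P]_w (expR (\sum_i if i \in s then u i * Y i w ^+ 2 else h i * Y i w))%:E =
    (\prod_i if i \in s then chi2_mgf (u i) else expR (h i ^+ 2 / 2))%:E.
  have := gen (enum I) (fun=> 0%R); under [in X in _ = X -> _]eq_bigr do rewrite mem_enum.
  by move=> <-; apply: eq_integral => w _; under [in RHS]eq_bigr do rewrite mem_enum.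
elim: s h => [|i0 s IH] h; first by rewrite mgfY expR_sum.
have [i0s|i0s] := boolP (i0 \in s).
  have E i : (i \in i0 :: s) = (i \in s) by rewrite inE; case: eqP => // ->.
  under eq_integral do under eq_bigr do rewrite E.
  by rewrite IH; under [in RHS]eq_bigr do rewrite E.
pose a := Num.sqrt (2 * u i0).
have aE : (a ^+ 2 = 2 * u i0)%R by rewrite sqr_sqrtr//; have := u2 i0; lra.
pose h' z i : R := if i == i0 then (a * z)%R else h i.
pose S w : R := (\sum_(i | i != i0) if i \in s then u i * Y i w ^+ 2 else h i * Y i w)%R.
have SE z w : (\sum_i (if i \in s then u i * Y i w ^+ 2 else h' z i * Y i w) =
    a * Y i0 w * z + S w)%R.
  rewrite (bigD1 i0)//= (negbTE i0s) /h' eqxx; congr (_ + _)%R; first by rewrite mulrAC.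
  by apply: eq_bigr => i /negbTE ->.
have mS : measurable_fun [set: T] S.
  pose g i w : R := if i != i0 then
    (if i \in s then u i * Y i w ^+ 2 else h i * Y i w)%R else 0%R.
  rewrite (_ : S = fun w => (\sum_i g i w)%R); last first.
    by apply/funext => w; rewrite /S big_mkcond.
  apply: measurable_sum => i; rewrite /g; case: (i != i0) => //.
  case: (i \in s); apply: measurable_funM => //; exact: measurable_funX.
transitivity (\int[P]_w \int[normal_prob 0 1]_z (expR (a * Y i0 w * z + S w))%:E).
  apply: eq_integral => w _.
  under [RHS]eq_integral do rewrite expRD mulrC EFinM.
  rewrite ge0_integralZl//; last first.
    by apply/measurable_EFinP; apply: measurableT_comp => //; exact: measurable_funM.
  rewrite normal_mgf ?oner_neq0// -EFinM -expRD; congr (expR _)%:E.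
  rewrite (bigD1 i0)//= inE eqxx/= addrC; congr (_ + _)%R; last first.
    by rewrite exprMn aE; field.
  by apply: eq_bigr => i ii0; rewrite inE (negbTE ii0).
have mZ : measurable_fun [set: T * R] (fun x => (expR (a * Y i0 x.1 * x.2 + S x.1))%:E).
  apply/measurable_EFinP; apply: measurableT_comp => //; apply: measurable_funD.
    apply: measurable_funM => //; apply: measurable_funM => //.
    exact: measurableT_comp.
  exact: measurableT_comp.
(* After Tonelli the inner integral is the induction hypothesis with coefficient a z at [i0]. It
   contributes e^(a^2 z^2 / 2) = e^(u z^2), whose mean over z is [chi2_mgf]. *)
transitivity (\int[normal_prob 0 1]_z \int[P]_w (expR (a * Y i0 w * z + S w))%:E).
  exact: (fubini_tonelli (m1 := P) (m2 := normal_prob 0 1)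
    (fun x => (expR (a * Y i0 x.1 * x.2 + S x.1))%:E)).
under eq_integral do under eq_integral do rewrite -SE.
under eq_integral do rewrite IH.
pose c : R := (\prod_(i | i != i0) if i \in s then chi2_mgf (u i) else expR (h i ^+ 2 / 2))%R.
have cE (z : R) : (\prod_i (if i \in s then chi2_mgf (u i) else expR (h' z i ^+ 2 / 2)) =
    c * expR (u i0 * z ^+ 2))%R.
  rewrite (bigD1 i0)//= (negbTE i0s) /h' eqxx mulrC; congr (_ * expR _)%R.
    by apply: eq_bigr => i /negbTE ->.
  by rewrite exprMn aE; field.
under eq_integral do rewrite cE EFinM.
have c0 : (0 <= c)%R.
  apply: prodr_ge0 => i _; case: ifP => _; last exact: expR_ge0.
  by rewrite ltW// chi2_mgf_gt0//; have /andP[] := u2 i.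
rewrite ge0_integralZl//; last first.
  by apply/measurable_EFinP; apply: measurableT_comp => //; exact: measurable_funM.
rewrite normal_sqr_mgf; last by have /andP[] := u2 i0.
rewrite -EFinM; congr EFin.
rewrite [RHS](bigD1 i0)//= inE eqxx/= mulrC; congr (_ * _)%R.
by apply: eq_bigr => i ii0; rewrite inE (negbTE ii0).
Qed.

End chi_square.

(** Both bounds are squared and compared with 1 / (1 - 2u). The lower one is called for by the
    negative coefficient of [chi2_mgf] in [chi2_lower_tail]. *)
Lemma chi2_mgf_bounds (R : realType) (u : R) : 0 <= u <= 1 / 6 ->
  1 + u <= chi2_mgf u <= 1 + u + 3 * u ^+ 2.
Proof.
move=> /andP[u0 u6].
have k0 : 0 < chi2_mgf u by apply: chi2_mgf_gt0; lra.
have k2 : chi2_mgf u ^+ 2 = (1 - 2 * u)^-1 by apply: sqr_chi2_mgf; lra.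
apply/andP; split.
  rewrite -(@ler_pXn2r _ 2) ?nnegrE ?k2; [|by []|lra|exact: ltW].
  rewrite -div1r ler_pdivlMr; nra.
rewrite -(@ler_pXn2r _ 2) ?nnegrE ?k2; [|by []|exact: ltW|nra].
rewrite -div1r ler_pdivrMr; last lra.
have -> : (1 + u + 3 * u ^+ 2) ^+ 2 * (1 - 2 * u) =
    1 + u ^+ 2 * (3 - 8 * u - 3 * u ^+ 2 - 18 * u ^+ 3) by ring.
rewrite lerDl mulr_ge0 ?sqr_ge0//.
have : u ^+ 2 <= 1 / 36 by nra.
rewrite (exprS _ 2); have := sqr_ge0 u; nra.
Qed.

Section markov.
Local Open Scope ereal_scope.
Context (disp : measure_display) (T : measurableType disp) (R : realType)
  (P : probability T R).

Lemma ge0_markov (f : T -> R) (a : R) : (0 <= a)%R ->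
  measurable_fun [set: T] f -> (forall w, (0 <= f w)%R) ->
  a%:E * P [set w | (a <= f w)%R] <= \int[P]_w (f w)%:E.
Proof.
move=> a0 mf f0.
have mA : measurable [set w | (a <= f w)%R].
  rewrite (_ : [set w | _] = f @^-1` `[a, +oo[%classic).
    by rewrite -[X in measurable X]setTI; exact: mf.
  by apply/seteqP; split => w /=; rewrite in_itv/= andbT.
rewrite -integral_cst//.
apply: (@le_trans _ _ (\int[P]_(w in [set w | (a <= f w)%R]) (f w)%:E)).
  apply: ge0_le_integral => //.
  by apply/measurable_EFinP; exact: measurable_funTS.
apply: ge0_subset_integral => //; first exact/measurable_EFinP.
by move=> w _; rewrite lee_fin.
Qed.

End markov.

Section chi_square_tails.
Local Open Scope ereal_scope.
Context (disp : measure_display) (T : measurableType disp) (R : realType)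
  (P : probability T R) (I : finType) (Y : I -> T -> R).
Context (mY : forall i, measurable_fun [set: T] (Y i)).
Context (mgfY : forall h : I -> R,
  \int[P]_w (expR (\sum_i h i * Y i w))%:E = (expR (\sum_i h i ^+ 2 / 2))%:E).

Let msum (u : I -> R) : measurable_fun [set: T] (fun w => \sum_i u i * Y i w ^+ 2)%R.
Proof.
by apply: measurable_sum => i; apply: measurable_funM => //; exact: measurable_funX.
Qed.

(** Chernoff bound at l = tau / 24: the exponent per degree of freedom is 3 l^2 - tau l = -7/192
    tau^2, which is below -tau^2 / 48. *)
Lemma chi2_upper_tail (tau : R) : (0 < tau <= 1)%R ->
  P [set w | ((1 + tau) * #|I|%:R <= \sum_i Y i w ^+ 2)%R] <=
  (expR (- (tau ^+ 2 / 48 * #|I|%:R)))%:E.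
Proof.
move=> /andP[t0 t1]; pose l : R := (tau / 24)%R.
have l0 : (0 < l)%R by rewrite divr_gt0.
have l24 : (l <= 1 / 24)%R by rewrite /l; lra.
have := integral_expR_sum_sqr mY mgfY (u := fun=> l).
move=> /(_ (fun=> _)); under eq_integral do rewrite -mulr_sumr.
move=> E; have {}E : \int[P]_w (expR (l * (\sum_i Y i w ^+ 2)))%:E =
    (chi2_mgf l ^+ #|I|)%:E by rewrite E ?prodr_const//; lra.
have mS : measurable_fun [set: T] (fun w => expR (l * \sum_i Y i w ^+ 2)).
  apply: measurableT_comp => //; under eq_fun do rewrite mulr_sumr.
  exact: msum.
have := ge0_markov P (expR_ge0 (l * ((1 + tau) * #|I|%:R))) mS (fun w => expR_ge0 _).
rewrite E.
have -> : [set w | (expR (l * ((1 + tau) * #|I|%:R)) <= expR (l * \sum_i Y i w ^+ 2))%R] =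
    [set w | ((1 + tau) * #|I|%:R <= \sum_i Y i w ^+ 2)%R].
  by apply/seteqP; split => w /=; rewrite ler_expR ler_pM2l.
rewrite muleC -lee_pdivlMr ?expR_gt0// => /le_trans; apply.
rewrite -EFinM lee_fin -expRN.
have k1 : (chi2_mgf l <= expR (l + 3 * l ^+ 2))%R.
  have /chi2_mgf_bounds/andP[_] : (0 <= l <= 1 / 6)%R by lra.
  by move=> /le_trans; apply; rewrite -addrA expR_ge1Dx.
have k0 : (0 <= chi2_mgf l)%R by apply/ltW/chi2_mgf_gt0; lra.
apply: (@le_trans _ _ (expR (l + 3 * l ^+ 2) ^+ #|I| *
    expR (- (l * ((1 + tau) * #|I|%:R))))%R).
  by rewrite ler_wpM2r ?expR_ge0// lerXn2r ?nnegrE ?expR_ge0.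
rewrite -expRM_natl -expRD ler_expR.
have : (0 <= #|I|%:R :> R)%R by [].
set n := #|I|%:R => n0.
rewrite -subr_ge0 (_ : _ - _ = n * (tau ^+ 2 / 64))%R; last first.
  by rewrite /l; field.
by rewrite mulr_ge0// divr_ge0 ?sqr_ge0.
Qed.

(* Pointwise, e^(-v) <= 3 - 3 e^v + e^(2v), whose mean is a combination of
   values of chi2_mgf at nonnegative arguments. *)
Lemma chi2_lower_tail (tau : R) : (0 < tau <= 1)%R ->
  P [set w | (\sum_i Y i w ^+ 2 <= (1 - tau) * #|I|%:R)%R] <=
  (expR (- (tau ^+ 2 / 48 * #|I|%:R)))%:E.
Proof.
(* This l minimizes 12 l^2 - tau l, with value -tau^2 / 48. *)
move=> /andP[t0 t1]; pose l : R := (tau / 24)%R.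
have l0 : (0 < l)%R by rewrite divr_gt0.
have l24 : (l <= 1 / 24)%R by rewrite /l; lra.
(* Coefficients of z^2 - 3 z + 3, which exceeds 1 / z by (z - 1)^3 / z, nonnegative for z >= 1. *)
pose q (j : 'I_3) : R := [:: 3; - 3; 1]%R`_j.
pose v (j : 'I_3) : R := (j%:R * l)%R.
have v2 j : (0 <= v j < 1 / 2)%R.
  by rewrite /v; case: j => [[|[|[|//]]]] /= _; lra.
pose F i w : R := (\sum_j q j * expR (v j * Y i w ^+ 2))%R.
have FE i w : F i w = (3 - 3 * expR (l * Y i w ^+ 2) + expR (l * Y i w ^+ 2) ^+ 2)%R.
  rewrite /F !big_ord_recl big_ord0 /q /v /= -expRM_natl.
  by rewrite !mul0r expR0 mulr1 !mul1r addr0 mulrA addrA mulNr.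
have FP i w : (expR (- l * Y i w ^+ 2) <= F i w)%R.
  rewrite FE mulNr expRN; set z := expR _.
  have z1 : (1 <= z)%R by rewrite -expR0 ler_expR mulr_ge0 ?sqr_ge0// ltW.
  rewrite -div1r ler_pdivrMr; last lra.
  rewrite -subr_ge0 (_ : _ - _ = (z - 1) ^+ 3)%R; last by ring.
  by rewrite exprn_ge0// subr_ge0.
have intF : \int[P]_w (\prod_i F i w)%:E =
    ((\sum_j q j * chi2_mgf (v j)) ^+ #|I|)%:E.
  (* Expanding the product gives exponentials of nonnegative combinations of squares, to which
     [integral_expR_sum_sqr] applies. Their coefficients may be negative, so integrability is
     required to exchange sum and integral. *)
  transitivity (\int[P]_w \sum_(f : {ffun I -> 'I_3})
      ((\prod_i q (f i))%R%:E * (expR (\sum_i v (f i) * Y i w ^+ 2))%:E)).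
    apply: eq_integral => w _; rewrite /F bigA_distr_bigA -sumEFin.
    by apply: eq_bigr => f _; rewrite big_split expR_sum EFinM.
  have intf (f : {ffun I -> 'I_3}) :
      \int[P]_w (expR (\sum_i v (f i) * Y i w ^+ 2))%:E = (\prod_i chi2_mgf (v (f i)))%:E.
    exact: integral_expR_sum_sqr.
  have mf (f : {ffun I -> 'I_3}) :
      measurable_fun [set: T] (fun w => (expR (\sum_i v (f i) * Y i w ^+ 2))%:E).
    apply/measurable_EFinP; apply: measurableT_comp => //; exact: msum.
  have integrablef (f : {ffun I -> 'I_3}) :
      P.-integrable [set: T] (fun w => (expR (\sum_i v (f i) * Y i w ^+ 2))%:E).
    apply/integrableP; split => //.
    under eq_integral do rewrite gee0_abs ?lee_fin ?expR_ge0//.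
    by rewrite intf ltry.
  rewrite integral_sum//; last by move=> f; exact: integrableZl.
  under eq_bigr do rewrite integralZl// intf -EFinM -big_split.
  rewrite sumEFin; congr EFin.
  rewrite -[LHS](bigA_distr_bigA (fun=> fun j => q j * chi2_mgf (v j))%R).
  by rewrite prodr_const.
have mF i : measurable_fun [set: T] (F i).
  apply: measurable_sum => j; apply: measurable_funM => //.
  apply: measurableT_comp => //; apply: measurable_funM => //.
  exact: measurable_funX.
have mS : measurable_fun [set: T] (fun w => expR (- l * \sum_i Y i w ^+ 2)).
  apply: measurableT_comp => //; under eq_fun do rewrite mulr_sumr.
  exact: msum.
have := ge0_markov P (expR_ge0 (- l * ((1 - tau) * #|I|%:R))) mS (fun w => expR_ge0 _).
have -> : [set w | (expR (- l * ((1 - tau) * #|I|%:R)) <= expR (- l * \sum_i Y i w ^+ 2))%R] =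
    [set w | (\sum_i Y i w ^+ 2 <= (1 - tau) * #|I|%:R)%R].
  by apply/seteqP; split => w /=; rewrite ler_expR !mulNr lerN2 ler_pM2l.
rewrite muleC -lee_pdivlMr ?expR_gt0// => /le_trans; apply.
have intS : \int[P]_w (expR (- l * \sum_i Y i w ^+ 2))%:E <= \int[P]_w (\prod_i F i w)%:E.
  apply: ge0_le_integral => //.
  - exact/measurable_EFinP.
  - by apply/measurable_EFinP; exact: measurable_prod.
  - move=> w _; rewrite lee_fin mulr_sumr expR_sum.
    by apply: ler_prod => i _; rewrite expR_ge0 FP.
apply: (le_trans (lee_wpmul2r _ intS)); first by rewrite lee_fin invr_ge0 expR_ge0.
rewrite intF -EFinM lee_fin -expRN.
have /andP[k1 k1'] : (1 + l <= chi2_mgf l <= 1 + l + 3 * l ^+ 2)%R.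
  by apply: chi2_mgf_bounds; lra.
have /andP[k2 k2'] : (1 + 2 * l <= chi2_mgf (2 * l) <= 1 + 2 * l + 3 * (2 * l) ^+ 2)%R.
  by apply: chi2_mgf_bounds; lra.
have -> : (\sum_j q j * chi2_mgf (v j) = 3 - 3 * chi2_mgf l + chi2_mgf (2 * l))%R.
  rewrite !big_ord_recl big_ord0 /q /v /= {1}/chi2_mgf.
  by rewrite !mul0r mulr0 subr0 sqrtr1 invr1 mulr1 !mul1r addr0 addrA mulNr.
set k := (_ - _ + _)%R.
have kle : (k <= expR (- l + 12 * l ^+ 2))%R.
  by apply: le_trans (expR_ge1Dx _); rewrite /k; nra.
have k0 : (0 <= k)%R by rewrite /k; nra.
apply: (@le_trans _ _ (expR (- l + 12 * l ^+ 2) ^+ #|I| *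
    expR (- (- l * ((1 - tau) * #|I|%:R))))%R).
  by rewrite ler_wpM2r ?expR_ge0// lerXn2r ?nnegrE ?expR_ge0.
rewrite -expRM_natl -expRD ler_expR /l le_eqVlt; apply/orP; left; apply/eqP.
by field.
Qed.

End chi_square_tails.

(** * Gaussian sensing operators *)

Section union_bound.
Local Open Scope ereal_scope.
Context (disp : measure_display) (T : measurableType disp) (R : realType)
  (P : probability T R).

Lemma probability_bigsetU_le (J : Type) (s : seq J) (B : J -> set T) (e : R) :
  (forall j, measurable (B j)) -> (forall j, P (B j) <= e%:E) ->
  P (\big[setU/set0]_(j <- s) B j) <= ((size s)%:R * e)%:E.
Proof.
move=> mB PB; elim: s => [|j s IH]; first by rewrite big_nil measure0 mul0r.
have mU : measurable (\big[setU/set0]_(i <- s) B i).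
  by apply: bigsetU_measurable => i _.
rewrite big_cons; apply: (le_trans (measureU2 _ (mB j) mU)).
by rewrite /= -[(size s).+1]add1n natrD mulrDl mul1r EFinD leeD.
Qed.

Lemma gaussian_mgf (v t : R) (X : {RV P >-> R}) : (0 < v)%R -> gaussian_RV 0 v X ->
  \int[P]_w (expR (t * X w))%:E = (expR (t ^+ 2 * v / 2))%:E.
Proof.
move=> v0 gX.
have mexp : measurable_fun [set: R] (fun x : R => (expR (t * x))%:E).
  by apply/measurable_EFinP; apply: measurableT_comp => //; exact: measurable_funM.
transitivity (\int[normal_prob 0 (Num.sqrt v)]_x (expR (t * x))%:E); last first.
  by rewrite normal_mgf ?sqr_sqrtr ?gt_eqF ?sqrtr_gt0// ltW.
have mX : measurable_fun [set: T] X by exact: measurable_funP.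
have E := @ge0_integral_density _ _ T (measurableTypeR R) R P (normal_prob 0 (Num.sqrt v))
  X (cst 1%R) (fun x => (expR (t * x))%:E) mX.
rewrite E//.
- by apply: eq_integral => w _; rewrite mule1.
- move=> B mB; rewrite -[RHS]/(\int[P]_(w in X @^-1` B) cst 1 w) integral_cst ?mul1e.
    exact/esym/gX.
  by rewrite -[X in measurable X]setTI; exact: mX.
Qed.

End union_bound.

Lemma sum_triple (V : nmodType) (I J K : finType) (F : I * J * K -> V) :
  \sum_p F p = \sum_i \sum_j \sum_k F (i, j, k).
Proof.
transitivity (\sum_p F (p.1, p.2)); first by apply: eq_bigr => -[].
rewrite -(pair_bigA _ (fun ij k => F (ij, k)))/=.
transitivity (\sum_p \sum_k F (p.1, p.2, k)); first by apply: eq_bigr => -[].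
by rewrite -(pair_bigA _ (fun i j => \sum_k F (i, j, k))).
Qed.

Section gaussian_sensing.
Context (disp : measure_display) (T : measurableType disp) (R : realType)
  (P : probability T R) (m n d : nat) (Zrv : 'I_d * 'I_m * 'I_n -> {RV P >-> R}).
Context (d0 : (0 < d)%N) (indepZ : independent_RVs Zrv)
  (gaussZ : forall kij, gaussian_RV 0 (d%:R^-1) (Zrv kij)).

Let Z (w : T) : 'I_d -> 'M[R]_(m, n) := fun k => \matrix_(i, j) Zrv (k, i, j) w.

Let isometric_at (tau : R) (A : 'M[R]_(m, n)) : set T :=
  [set w | (1 - tau) * frob_norm A ^+ 2 <= frob_norm (sensing (Z w) A) ^+ 2
           <= (1 + tau) * frob_norm A ^+ 2].

(** The exponent is linear in the independent entries, so the integral factors. As the entries have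
    variance 1/d, the hypothesis on [c] makes the scaled measurements standard Gaussian. *)
Lemma gaussian_sensing_mgf (c : R) (A : 'M[R]_(m, n)) (h : 'I_d -> R) :
  c ^+ 2 * frob_norm A ^+ 2 = d%:R ->
  (\int[P]_w (expR (\sum_k h k * (c * frob_inner (Z w k) A)))%:E =
  (expR (\sum_k h k ^+ 2 / 2))%:E)%E.
Proof.
move=> cA.
have d0' : 0 < d%:R :> R by rewrite ltr0n.
pose a (p : 'I_d * 'I_m * 'I_n) : R := h p.1.1 * c * A p.1.2 p.2.
have aZ w : \sum_k h k * (c * frob_inner (Z w k) A) = \sum_p a p * Zrv p w.
  rewrite sum_triple.
  apply: eq_bigr => k _; rewrite mulrA frob_innerE mulr_sumr; apply: eq_bigr => i _.
  by rewrite mulr_sumr; apply: eq_bigr => j _; rewrite /a/= mxE mulrCA mulrC.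
under eq_integral do rewrite aZ expR_sum.
have mgfp p : (\int[P]_w (expR (a p * Zrv p w))%:E = (expR (a p ^+ 2 / d%:R / 2))%:E)%E.
  by rewrite (gaussian_mgf _ _ (gaussZ p)) ?invr_gt0.
rewrite (independent_RVs_integral_prod (F := fun p x => expR (a p * x)))//.
- under eq_bigr do rewrite mgfp.
  rewrite prodEFin -expR_sum; congr (expR _)%:E.
  rewrite sum_triple.
  apply: eq_bigr => k _.
  transitivity (h k ^+ 2 * c ^+ 2 * frob_norm A ^+ 2 / d%:R / 2).
    rewrite sqr_frob_normE !mulr_sumr !mulr_suml; apply: eq_bigr => i _.
    rewrite !mulr_sumr !mulr_suml; apply: eq_bigr => j _.
    by rewrite /a/= !exprMn.
  by rewrite -(mulrA (h k ^+ 2)) cA mulfK// gt_eqF.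
- move=> p; apply: measurableT_comp => //; exact: measurable_funM.
- by move=> p; rewrite mgfp ltry.
Qed.

Lemma measurable_gaussian_sensing (c : R) (A : 'M[R]_(m, n)) k :
  measurable_fun [set: T] (fun w => c * frob_inner (Z w k) A).
Proof.
apply: measurable_funM => //; under eq_fun do rewrite frob_innerE.
apply: measurable_sum => i; apply: measurable_sum => j; apply: measurable_funM => //.
by under eq_fun do rewrite mxE; exact: measurable_funP.
Qed.

Lemma measurable_isometric_at tau A : measurable (isometric_at tau A).
Proof.
have mf : measurable_fun [set: T] (fun w => frob_norm (sensing (Z w) A) ^+ 2).
  under eq_fun do rewrite sqr_frob_norm_sensing.
  apply: measurable_sum => k; apply: measurable_funX.
  under eq_fun do rewrite -[frob_inner _ _]mul1r.
  exact: measurable_gaussian_sensing.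
rewrite (_ : isometric_at tau A = (fun w => frob_norm (sensing (Z w) A) ^+ 2) @^-1`
    `[(1 - tau) * frob_norm A ^+ 2, (1 + tau) * frob_norm A ^+ 2]).
  by rewrite -[X in measurable X]setTI; exact: mf.
by apply/seteqP; split => w /=; rewrite in_itv.
Qed.

(** Scaling the measurements by sqrt(d) / |A| turns the failure of the isometry at [A] into two
    chi-square tails, one for each inequality. *)
Lemma probability_isometric_at tau A : 0 < tau <= 1 ->
  (P (~` isometric_at tau A) <= (2 * expR (- (tau ^+ 2 / 48 * d%:R)))%:E)%E.
Proof.
move=> tau01.
have d0' : 0 < d%:R :> R by rewrite ltr0n.
have [->|A0] := eqVneq A 0.
  rewrite (_ : ~` _ = set0) ?measure0 ?lee_fin ?mulr_ge0 ?expR_ge0//.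
  apply/seteqP; split => w //=; apply.
  by rewrite /isometric_at/= sensing0 !frob_norm0 expr0n !mulr0 lexx.
have a0 : 0 < frob_norm A ^+ 2 by rewrite exprn_gt0// frob_norm_gt0.
pose c := Num.sqrt (d%:R / frob_norm A ^+ 2).
have cA : c ^+ 2 * frob_norm A ^+ 2 = d%:R.
  by rewrite sqr_sqrtr ?divr_ge0 ?ltW// divfK// gt_eqF.
pose Y k w := c * frob_inner (Z w k) A.
have YE w : \sum_k Y k w ^+ 2 = d%:R / frob_norm A ^+ 2 * frob_norm (sensing (Z w) A) ^+ 2.
  rewrite sqr_frob_norm_sensing mulr_sumr; apply: eq_bigr => k _.
  by rewrite exprMn sqr_sqrtr// divr_ge0// ltW.
have mY k : measurable_fun [set: T] (Y k) by exact: measurable_gaussian_sensing.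
have mgfY h : (\int[P]_w (expR (\sum_k h k * Y k w))%:E =
    (expR (\sum_k h k ^+ 2 / 2))%:E)%E by exact: gaussian_sensing_mgf.
have up := chi2_upper_tail mY mgfY tau01; have lo := chi2_lower_tail mY mgfY tau01.
rewrite !card_ord in up lo.
have mY2 : measurable_fun [set: T] (fun w => \sum_k Y k w ^+ 2).
  by apply: measurable_sum => k; exact: measurable_funX.
have mup : measurable [set w | (1 + tau) * d%:R <= \sum_k Y k w ^+ 2].
  rewrite (_ : [set w | _] = (fun w => \sum_k Y k w ^+ 2) @^-1` `[(1 + tau) * d%:R, +oo[).
    by rewrite -[X in measurable X]setTI; exact: mY2.
  by apply/seteqP; split => w /=; rewrite in_itv/= andbT.
have mlo : measurable [set w | \sum_k Y k w ^+ 2 <= (1 - tau) * d%:R].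
  rewrite (_ : [set w | _] = (fun w => \sum_k Y k w ^+ 2) @^-1` `]-oo, (1 - tau) * d%:R]).
    by rewrite -[X in measurable X]setTI; exact: mY2.
  by apply/seteqP; split => w /=; rewrite in_itv.
rewrite mulr_natl mulr2n EFinD; apply: le_trans (leeD up lo).
apply: le_trans (measureU2 _ mup mlo).
apply: le_measure; rewrite ?inE; first exact/measurableC/measurable_isometric_at.
  exact: measurableU.
move=> w /=; rewrite /isometric_at/= => /negP; rewrite negb_and -!ltNge YE.
have rescale b : b * d%:R = d%:R / frob_norm A ^+ 2 * (b * frob_norm A ^+ 2).
  by field; rewrite -sqrf_eq0 gt_eqF.
by move=> /orP[H|H]; [right|left]; rewrite rescale ler_wpM2l ?divr_ge0 ?ltW.
Qed.

(** Union bound over the net with N = 200, whence 402 = 2 N + 2. The event constrains finitely many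
    net points, so it is measurable, yet it yields the isometry for all matrices of rank <= [s]. *)
Lemma gaussian_rip_net (s : nat) : (0 < m)%N -> (0 < n)%N -> (0 < s)%N ->
  exists E : set T, [/\ measurable E,
    ((1 - 4 ^+ (402 * (s * (m + n))) * (2 * expR (- (50^-1 ^+ 2 / 48 * d%:R))))%:E <= P E)%E &
    forall w, E w -> rip (Z w) s (1 / 9)].
Proof.
move=> m0 n0 s0.
have [J [phi [Jle net]]] := @low_rank_net R m n s 200 m0 n0 s0 isT.
pose U := \big[setU/set0]_(j <- enum J) ~` isometric_at 50^-1 (phi j).
have mU : measurable U.
  by apply: bigsetU_measurable => j _; exact/measurableC/measurable_isometric_at.
have PU : (P U <= (4 ^+ (402 * (s * (m + n))) * (2 * expR (- (50^-1 ^+ 2 / 48 * d%:R))))%:E)%E.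
  apply: (le_trans (probability_bigsetU_le _ _
    (e := 2 * expR (- (50^-1 ^+ 2 / 48 * d%:R))) _)).
  - by move=> j; exact/measurableC/measurable_isometric_at.
  - by move=> j; apply: probability_isometric_at; lra.
  rewrite lee_fin ler_wpM2r ?mulr_ge0 ?expR_ge0// -cardE.
  by rewrite -natrX ler_nat.
exists (~` U); split; first exact: measurableC.
  by rewrite probability_setC// EFinB leeB.
move=> w Uw; apply: net_rip net _ => j.
apply: contrapT => H; apply: Uw.
by rewrite /U -bigcup_seq; exists j => //=; rewrite mem_enum.
Qed.

End gaussian_sensing.

(** Half of the concentration exponent pays for the net and the other half is kept as [c1]. The
    factor 2 is absorbed into 4^N, which turns 402 into 403. *)
Lemma gaussian_rip_constants (R : realType) : exists (c0 : nat) (c1 : R),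
  [/\ (0 < c0)%N, 0 < c1 & forall N : nat, (0 < N)%N ->
    4 ^+ (402 * N) * (2 * expR (- (50^-1 ^+ 2 / 48 * (c0 * N)%:R))) <=
    expR (- (c1 * (c0 * N)%:R))].
Proof.
pose g : R := 50^-1 ^+ 2 / 96.
have g0 : 0 < g by rewrite divr_gt0// exprn_gt0// invr_gt0.
pose c0 := (Num.bound (403 * ln 4 / g)).+1.
exists c0, g; split => // N N0.
have ln4 : 0 <= ln (4 : R) by rewrite ln_ge0// ler1n.
have c0g : 403 * ln 4 <= g * c0%:R.
  have x0 : 0 <= 403 * ln 4 / g by rewrite divr_ge0 ?mulr_ge0// ltW.
  rewrite [leRHS]mulrC -ler_pdivrMr//; apply: ltW.
  apply: (lt_le_trans (archi_boundP x0)).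
  by rewrite ler_nat.
have N1 : 1 <= N%:R :> R by rewrite ler1n.
apply: (@le_trans _ _ (expR (403 * ln 4 * N%:R) * expR (- (2 * g * (c0 * N)%:R)))).
  have -> : 50^-1 ^+ 2 / 48 = 2 * g by rewrite /g; field.
  rewrite mulrA ler_wpM2r ?expR_ge0//.
  apply: (@le_trans _ _ (4 ^+ (402 * N) * 4 ^+ N)).
    rewrite ler_wpM2l ?exprn_ge0//.
    by rewrite -natrX ler_nat (@leq_trans (4 ^ 1))// leq_exp2l.
  rewrite -exprD -{1}[4 in leLHS]lnK ?posrE// -expRM_natl ler_expR.
  by rewrite -[X in (_ + X)%N]mul1n -mulnDl natrM mulrAC.
rewrite -expRD ler_expR natrM.
have : 403 * ln 4 * N%:R <= g * c0%:R * N%:R by rewrite ler_wpM2r// ltW// (lt_le_trans _ N1).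
lra.
Qed.

Theorem theorem1 (R : realType) :
  exists (c0 : nat) (c1 C Ct Dt : R),
    [/\ (0 < c0)%N, 0 < c1, 0 < C, 0 < Ct & 0 < Dt] /\
    forall (m n r : nat) (delta L : R) (f : 'M[R]_(m, n) -> R),
      (1 <= r)%N -> (r <= m)%N -> (m <= n)%N ->
      0 < delta < 1 ->
      (forall X, differentiable f X) ->
      L_smooth L f ->
      (forall X, approx_low_rank delta r (grad f X)) ->
    forall d : nat, d = (2 * c0 * r * (m + n))%N ->
    forall (disp : measure_display) (T : measurableType disp)
      (P : probability T R) (Zrv : 'I_d * 'I_m * 'I_n -> {RV P >-> R}),
      independent_RVs Zrv ->
      (forall kij, gaussian_RV 0 (d%:R^-1) (Zrv kij)) ->
    let Z (w : T) : 'I_d -> 'M[R]_(m, n) :=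
      fun k => \matrix_(i, j) Zrv (k, i, j) w in
    forall (X : T -> 'M[R]_(m, n)) (t : T -> nat)
      (G : T -> nat -> 'M[R]_(m, n)),
    let g (w : T) : 'M[R]_(m, n) := grad f (X w) in
    let y (w : T) : 'cV[R]_d := sensing (Z w) (g w) in
      (forall w, is_iht (Z w) (y w) r (1 / (1 + fine (ric (Z w) (2 * r)))) (G w)) ->
      (forall w, g w != 0 -> y w != 0 ->
        Dt * ln (frob_norm (y w) ^+ 2 /
                 ((Ct * (m%:R / r%:R) + 2) * delta ^+ 2 * frob_norm (g w) ^+ 2))
          <= (t w)%:R) ->
    exists E : set T,
      [/\ measurable E,
          ((1 - expR (- (c1 * d%:R)))%:E <= P E)%E &
          forall w, E w ->
            (ric (Z w) (2 * r) < (1 / 3)%:E)%E /\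
            frob_norm (g w - G w (t w)) ^+ 2 <=
              (8 * C * (m%:R / r%:R) + 5) * delta ^+ 2 * frob_norm (g w) ^+ 2].
Proof.
have [c0 [c1 [c0_gt0 c1_gt0 c01P]]] := gaussian_rip_constants R.
(* The last three values are those built into [iht_error]. *)
exists c0, c1, 6, 1, (ln 2)^-1; split.
  by split; rewrite ?invr_gt0 ?ln_gt0 ?ltr1n.
move=> m n r delta L f r1 rm mn /andP[delta0 _] _ _ lowf d dE disp T P Zrv.
move=> indepZ gaussZ Z X t G g y ihtG tge.
have m0 : (0 < m)%N by exact: leq_trans r1 rm.
have n0 : (0 < n)%N by exact: leq_trans m0 mn.
have s0 : (0 < 2 * r)%N by rewrite muln_gt0.
have N0 : (0 < 2 * r * (m + n))%N by rewrite muln_gt0 s0 addn_gt0 m0.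
have {}dE : d = (c0 * (2 * r * (m + n)))%N by rewrite dE; lia.
have d0 : (0 < d)%N by rewrite dE muln_gt0 c0_gt0.
have [E [mE PE ripE]] := gaussian_rip_net d0 indepZ gaussZ m0 n0 s0.
exists E; split => //.
  apply: le_trans PE; rewrite lee_fin lerB// [X in _ * X%:R]dE.
  by rewrite [X in expR (- (c1 * X%:R))]dE; exact: c01P.
(* The event concerns [Z] alone, and the rest is deterministic in [w], however [X w] depends on
   [Z w]. As 1/9 is admissible, the constant in the step size is at most 1/9. *)
move=> w /ripE ripw.
have x01 : 0 < (1 / 9 : R) < 1 by lra.
have [rho19 ricE riprho] := ric_attained x01 ripw.
split; first by rewrite ricE lte_fin; lra.
exact: (iht_error r1 rm delta0 rho19 riprho (lowf (X w)) (ihtG w) (tge w)).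
Qed.
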